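(* The polarized variety $\bigl(T\backslash\!\backslash (X^{id}_{w_{3,7}})^{ss}_T(\mathcal{L}(7\omega_3)),\ \tilde{\mathcal{L}}(7\omega_3)\bigr)$ is a rational normal scroll.
   Context: $G=SL(7,\mathbb{C})$, $T$ is the subgroup of diagonal matrices, $B$ (resp. $B^-$) the subgroup of upper (resp. lower) triangular matrices, and $G_{3,7}$ is the Grassmannian of $3$-dimensional subspaces of $\mathbb{C}^7$. For increasing triples $v,w$ in $\{1,\dots,7\}$ put $e_w=[e_{w(1)}\wedge e_{w(2)}\wedge e_{w(3)}]$; $X(w)$ is the closure of $Be_w$, $X^v$ the closure of $B^-e_v$, and $X^v_w=X(w)\cap X^v$. Here $w_{3,7}=[3,5,7]$ and $id=[1,2,3]$, so $X^{id}_{w_{3,7}}=X(w_{3,7})$. $\mathcal{L}(\omega_3)$ is the pullback of $\mathcal{O}(1)$ under the Plücker embedding with its natural $T$-linearization, and $\mathcal{L}(7\omega_3)=\mathcal{L}(\omega_3)^{\otimes7}$. The semistable locus $X^{ss}_T(\mathcal{L})$ is the set of points of $X$ at which some $T$-invariant section of a positive power of $\mathcal{L}$ does not vanish, and the GIT quotient is $T\backslash\!\backslash X^{ss}_T(\mathcal{L})=\mathrm{Proj}\bigoplus_{m\ge0}H^0(X,\mathcal{L}^{\otimes m})^T$. $\tilde{\mathcal{L}}(7\omega_3)$ is the line bundle on the GIT quotient to which $\mathcal{L}(7\omega_3)$ descends; its space of sections is $H^0(X(w_{3,7}),\mathcal{L}(7\omega_3))^T$. The assertion refers to the embedding of the quotient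 in projective space given by the complete linear system of $\tilde{\mathcal{L}}(7\omega_3)$. *)

(* Defs.v *)
From HB Require Import structures.
From mathcomp Require Import all_boot all_order all_algebra.
From mathcomp Require Import boolp classical_sets reals.
From mathcomp Require Import complex mpoly.

Set Implicit Arguments.
Unset Strict Implicit.
Unset Printing Implicit Defensive.

Import GRing.Theory.
Local Open Scope ring_scope.
Local Open Scope classical_set_scope.

(* Classical varieties over an algebraically closed field F are described as
   spaces with functions: a set of (closed) points, its Zariski-open subsets,
   and, for each open U, the regular functions on U.  The values outside U of
   a function that is regular on U are irrelevant. *)
Record space_with_functions (F : Type) := SpaceWithFunctions {
  point :> Type;
  is_open : set (set point);
  regular : set point -> set (point -> F) }.

Definition zariski_closure F (Y : space_with_functions F) (S : set Y) : set Y :=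
  [set x | forall U : set Y, is_open U -> U x -> U `&` S !=set0].

(* phi is regular on U `&` Z for the structure that Z inherits from Y. *)
Definition regular_in F (Y : space_with_functions F) (Z U : set Y)
    (phi : Y -> F) : Prop :=
  forall x, U x -> Z x -> exists (W : set Y) (psi : Y -> F),
    [/\ is_open W, W x, regular W psi &
        forall y, W y -> U y -> Z y -> phi y = psi y].

(* h is an isomorphism from Y onto Z, with the structure induced by P on Z. *)
Definition embedding_onto F (Y P : space_with_functions F) (h : Y -> P)
    (Z : set P) : Prop :=
  [/\ injective h,
      range h = Z,
      forall U : set Y, is_open U <-> exists2 W, is_open W & U = h @^-1` W &
      forall (U : set P) (phi : P -> F), is_open U ->
        regular (h @^-1` U) (phi \o h) <-> regular_in Z U phi].

Section ProjectiveSpace.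
Variables (F : fieldType) (I : finType).

Definition coord_vec : Type := {ffun I -> F^o}.

Definition heval (P : {mpoly F[#|I|]}) (v : coord_vec) : F :=
  P.@[fun k => v (enum_val k)].

(* The points of the projective space with homogeneous coordinates indexed
   by I are the lines of F^I. *)
Definition line : Type := {L : {vspace {ffun I -> F^o}} | \dim L == 1%N}.

Definition vanishes (P : {mpoly F[#|I|]}) (L : line) : Prop :=
  forall v : coord_vec, v \in val L -> heval P v = 0.

Definition line_open (U : set line) : Prop :=
  exists2 S : set {mpoly F[#|I|]},
    (forall P, S P -> exists d : nat, P \is d.-homog) &
    U = [set L | exists2 P, S P & ~ vanishes P L].

Definition line_regular (U : set line) (phi : line -> F) : Prop :=
  forall L, U L -> exists (d : nat) (P Q : {mpoly F[#|I|]}),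
    [/\ P \is d.-homog, Q \is d.-homog, ~ vanishes Q L &
        forall M (v : coord_vec), U M -> v \in val M -> heval Q v != 0 ->
          phi M = heval P v / heval Q v].

Definition pspace : space_with_functions F :=
  SpaceWithFunctions line_open line_regular.

(* The punctured affine cone over X. *)
Definition cone (X : set pspace) : set coord_vec :=
  [set v | v != 0 /\ exists2 L : line, X L & v \in val L].

(* H^0(X, O(m)): a section of O(m) is a function on the punctured cone that
   is locally a quotient P/Q of homogeneous polynomials, deg P - deg Q = m.
   It is extended by 0 outside the cone, so that equal sections are equal
   functions. *)
Definition H0 (X : set pspace) (m : nat) : set (coord_vec -> F) :=
  [set f | (forall v, ~ cone X v -> f v = 0) /\
    forall v, cone X v -> exists (d : nat) (P Q : {mpoly F[#|I|]}),
      [/\ P \is (d + m)%N.-homog, Q \is d.-homog, heval Q v != 0 &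
          forall u, cone X u -> heval Q u != 0 -> f u = heval P u / heval Q u]].

End ProjectiveSpace.

Section Proj.
Variables (F : fieldType) (V : Type).

(* A graded F-algebra of F-valued functions on V is given by its
   homogeneous components A 0, A 1, ...; likewise for homogeneous ideals. *)
Definition graded : Type := nat -> set (V -> F).

(* The closed points of Proj A, for A finitely generated over an algebraically
   closed F: the homogeneous primes p that do not contain the irrelevant ideal
   and have residue field F.  The last clause is the latter condition: the
   degree-0 fraction f / g takes a value c in F at p. *)
Record is_proj_point (A p : graded) : Prop := IsProjPoint {
  pp_sub : forall m, p m `<=` A m;
  pp_zero : forall m, p m (fun=> 0);
  pp_lin : forall m (c : F) f g, p m f -> p m g ->
    p m (fun v => c * f v + g v);
  pp_ideal : forall n m f g, A n f -> p m g -> p (n + m)%N (fun v => f v * g v);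
  pp_prime : forall n m f g, A n f -> A m g ->
    p (n + m)%N (fun v => f v * g v) -> p n f \/ p m g;
  pp_relevant : exists (m : nat) (f : V -> F), [/\ (0 < m)%N, A m f & ~ p m f];
  pp_residue : forall m f g, A m f -> A m g -> ~ p m g ->
    exists c : F, p m (fun v => f v - c * g v) }.

Record proj_point (A : graded) : Type := ProjPoint {
  ideal_of :> graded;
  ideal_ofP : is_proj_point A ideal_of }.

Definition proj_open (A : graded) (U : set (proj_point A)) : Prop :=
  exists2 S : graded, (forall m, S m `<=` A m) &
    U = [set p : proj_point A | exists m f, S m f /\ ~ ideal_of p m f].

(* Locally phi is a fraction f / g of elements of the same degree. *)
Definition proj_regular (A : graded) (U : set (proj_point A))
    (phi : proj_point A -> F) : Prop :=
  forall p, U p -> exists (m : nat) (f g : V -> F),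
    [/\ A m f, A m g, ~ ideal_of p m g &
        forall q, U q -> ~ ideal_of q m g ->
          ideal_of q m (fun v => f v - phi q * g v)].

Definition Proj (A : graded) : space_with_functions F :=
  SpaceWithFunctions (@proj_open A) (@proj_regular A).

Definition is_basis (J : finType) (E : set (V -> F)) (s : J -> V -> F) : Prop :=
  (forall j, E (s j)) /\
  forall f, E f -> exists! c : {ffun J -> F},
    f = (fun v => \sum_j c j * s j v).

(* h is the everywhere defined morphism p |-> [s_j(p)]_j given by the
   sections s_j, of degree 1, of the bundle O(1) on Proj A. *)
Definition given_by_sections (A : graded) (J : finType) (s : J -> V -> F)
    (h : Proj A -> pspace F J) : Prop :=
  forall p : proj_point A, (exists j, ~ ideal_of p 1%N (s j)) /\
    forall z : coord_vec F J, z \in val (h p) ->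
    forall i j, ideal_of p 1%N (fun v => z i * s j v - z j * s i v).

End Proj.

Section Scroll.
Variables (F : fieldType) (d : nat) (a : 'I_d -> nat).

Definition scroll_index : finType := {i : 'I_d & 'I_(a i).+1}.

(* A point of the span of the points with parameter [x : y] on the d rational
   normal curves [x : y] |-> [x^(a i) : x^(a i - 1) y : ... : y^(a i)]
   lying in complementary subspaces of dimensions a i. *)
Definition scroll_vec (x y : F) (lam : 'I_d -> F) : coord_vec F scroll_index :=
  [ffun u : scroll_index =>
     lam (tag u) * x ^+ (a (tag u) - tagged u)%N * y ^+ (tagged u)].

(* Since val L has dimension 1, the vector below is automatically nonzero. *)
Definition scroll : set (pspace F scroll_index) :=
  [set L : line F scroll_index |
    exists x y lam, val L = <[scroll_vec x y lam]>%VS].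

End Scroll.

(* The polarized variety (Proj A, O(1)), where H^0(O(1)) = A 1, is a rational
   normal scroll: the complete linear system of O(1) embeds Proj A onto some
   S(a_1, ..., a_d).  Scrolls are taken up to projective equivalence, which is
   the choice of the basis s of A 1.  All a_i are positive, that is,
   S(a_1, ..., a_d) is the projective bundle of O(a_1) + ... + O(a_d) over P^1,
   not a cone. *)
Definition is_rational_normal_scroll (F : fieldType) (V : Type)
    (A : graded F V) : Prop :=
  exists (d : nat) (a : 'I_d -> nat) (s : scroll_index a -> V -> F)
         (h : Proj A -> pspace F (scroll_index a)),
    [/\ (0 < d)%N /\ (forall i, (0 < a i)%N),
        is_basis (A 1%N) s,
        given_by_sections s h &
        embedding_onto h (scroll (F := F) (a := a))].

Section Schubert.
Variables (F : fieldType) (r n : nat).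

(* Increasing r-tuples in {0, ..., n-1}: entries are shifted by one with
   respect to {1, ..., n}. *)
Definition incr : finType :=
  {t : r.-tuple 'I_n | sorted ltn (map val (val t))}.

(* The basis of the r-th exterior power of F^n is indexed by incr;
   wedge_act g is the r-th exterior power of g, whose entries are minors. *)
Definition wedge_act (g : 'M[F]_n) (v : coord_vec F incr) : coord_vec F incr :=
  [ffun I : incr =>
     \sum_(J : incr) \det (mxsub (tnth (val I)) (tnth (val J)) g) * v J].

Definition e_ (w : incr) : coord_vec F incr := [ffun J => (J == w)%:R].

Definition torus : set 'M[F]_n := [set t | \det t = 1 /\ is_diag_mx t].
Definition borel : set 'M[F]_n := [set b | \det b = 1 /\ is_trig_mx b^T].
Definition opp_borel : set 'M[F]_n := [set b | \det b = 1 /\ is_trig_mx b].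

Definition orbit_of (K : set 'M[F]_n) (w : incr) : set (pspace F incr) :=
  [set L : line F incr | exists2 g, K g & val L = <[wedge_act g (e_ w)]>%VS].

(* The closures are taken in the Pluecker space, in which the Grassmannian
   is closed. *)
Definition schubert (w : incr) : set (pspace F incr) :=
  zariski_closure (orbit_of borel w).
Definition opp_schubert (v : incr) : set (pspace F incr) :=
  zariski_closure (orbit_of opp_borel v).
Definition richardson (v w : incr) : set (pspace F incr) :=
  schubert w `&` opp_schubert v.

(* H^0(X, L(k omega_r))^T; the natural linearization of L(omega_r) = O(1)
   comes from the action of T on the exterior power. *)
Definition H0T (X : set (pspace F incr)) (k : nat) :
    set (coord_vec F incr -> F) :=
  [set f | H0 X k f /\
    forall t v, torus t -> cone X v -> f (wedge_act t v) = f v].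

(* The graded algebra of the T-invariant sections of the powers of
   L(k omega_r); its Proj is the GIT quotient of X. *)
Definition git_ring (X : set (pspace F incr)) (k : nat) :
    graded F (coord_vec F incr) :=
  fun m => H0T X (k * m)%N.

End Schubert.

Definition id37 : incr 3 7 :=
  exist _ [tuple @Ordinal 7 0 isT; @Ordinal 7 1 isT; @Ordinal 7 2 isT] isT.

(* [3, 5, 7], with entries shifted by one. *)
Definition w37 : incr 3 7 :=
  exist _ [tuple @Ordinal 7 2 isT; @Ordinal 7 4 isT; @Ordinal 7 6 isT] isT.

(* Main.v *)
Require Import Defs.
From mathcomp Require Import all_boot all_order all_algebra.
From mathcomp Require Import reals complex.
From mathcomp Require Import boolp classical_sets mpoly qpoly ring zify.

(** The Schubert variety X of w_{3,7} consists of the subspaces spanned by the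
    columns of a 7 x 3 matrix of rank 3 whose columns have their nonzero entries
    in the first 3, 5 and 7 rows.  Diagonal matrices on the left and unitriangular
    matrices on the right bring a generic such matrix to the form
    [slice a b p q w], with rows

      (1,0,0), (1,a,-p), (1,b,-q), (0,1,0), (0,1,w), (0,0,1), (0,0,1).

    So a T-invariant section is determined by its restriction to this slice of
    dimension 5 ([H0T_eq_slice]).  One minor of [slice] is constantly 1, so the
    slice stays in the punctured cone over X, and the restriction of a section
    is a function on affine 5-space that is everywhere locally a fraction of
    polynomials.  Such a function is a polynomial
    ([locally_fraction_polyfun]); this replaces any appeal to normality of X or
    to standard monomials.

    A torus of rank 2 still acts on the slice.  For a section of the m-th power
    of L(7 omega_3), invariance under it forces the polynomial to have degree
    2m in (a, b, p, q) and degree m in (p, q, w) ([slice_point_bihomog]).  The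
    monomials of this bidegree are exactly the products of m factors among

      a p, b p;   a q, b q;   a^2 w, a b w, b^2 w,

    which are the coordinates of the parametrization of the scroll S(1,1,2) at
    the parameter [a : b] of the line and the weights (p, q, w)
    ([scroll_monomial]).  Conversely, each of the seven is the restriction of a
    product of seven Pluecker coordinates in which every index from 1 to 7
    occurs three times, so that the product is T-invariant.  Hence the
    invariant ring is generated by these seven sections of degree 1
    ([git_ring_generated]).

    For any algebra generated in degree 1 by functions s_j, the sections s_j
    embed Proj onto the set of points at which all forms vanish that vanish
    identically on the s_j ([proj_embedding]).  Here these forms are the ones
    that vanish on the scroll; among them are the 2 x 2 minors that define the
    scroll, so the image is S(1,1,2) ([kernel_locus_scroll]). *)

Set Implicit Arguments.
Unset Strict Implicit.
Unset Printing Implicit Defensive.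

Import GRing.Theory.
Local Open Scope ring_scope.
Local Open Scope classical_set_scope.

(** * Polynomials and functions that are locally fractions *)

(** Monomials are built from 1 one variable at a time, which avoids working
    with exponent vectors in the inductions on polynomials below. *)
Lemma mpolyX_ind n (R : nzRingType) (P : nat -> {mpoly R[n]} -> Prop) :
    P 0%N 1 ->
    (forall d i p, P d p -> P d.+1 ('X_i * p)) ->
  forall m, P (mdeg m) 'X_[m].
Proof.
move=> P1 PX m; move dm: (mdeg m) => d.
elim: d m dm => [|d IH] m dm.
  by move/eqP: dm; rewrite mdeg_eq0 => /eqP->; rewrite mpolyX0.
have [i mi] : exists i, (0 < m i)%N.
  case: (pickP (fun i => (0 < m i)%N)) => [i mi|m0]; first by exists i.
  suff : mdeg m = 0%N by rewrite dm.
  by rewrite mdegE big1 // => i _; move: (m0 i); rewrite lt0n => /negbFE/eqP.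
have Ui : (U_(i) <= m)%MM by rewrite lep1mP -lt0n.
rewrite -(submK Ui) addmC mpolyXD; apply: (PX d); apply: IH.
apply: succn_inj; rewrite -dm -{2}(submK Ui) mdegD mdeg1; lia.
Qed.

(** Identities and closure properties of forms are proved with this induction:
    multiplying by one variable raises the degree by one. *)
Lemma dhomog_ind n (R : nzRingType) (P : nat -> {mpoly R[n]} -> Prop) :
    P 0%N 1 ->
    (forall d i p, P d p -> P d.+1 ('X_i * p)) ->
    (forall d, P d 0) ->
    (forall d c p q, P d p -> P d q -> P d (c *: p + q)) ->
  forall d p, p \is d.-homog -> P d p.
Proof.
move=> P1 PX P0 Plin d p /dhomogP /= hp; rewrite [p]mpolyE big_seq.
elim/big_rec: _ => [|m q mp Pq]; first exact: P0.
by apply: Plin => //; rewrite -(hp _ mp); apply: mpolyX_ind.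
Qed.

Lemma mpoly_ind n (R : nzRingType) (P : {mpoly R[n]} -> Prop) :
    P 1 -> (forall i p, P p -> P ('X_i * p)) -> P 0 ->
    (forall c p q, P p -> P q -> P (c *: p + q)) ->
  forall p, P p.
Proof.
move=> P1 PX P0 Plin p; rewrite [p]mpolyE.
elim/big_rec: _ => [|m q _ Pq]; first exact: P0.
by apply: Plin => //; apply: (mpolyX_ind (P := fun=> P)) => // _ i r; apply: PX.
Qed.

Section MevalCurve.
Variables (n : nat) (R : comNzRingType).
Implicit Types (p : {mpoly R[n]}) (c : 'I_n -> {poly R}).

Lemma horner_mmap p c t : (mmap polyC c p).[t] = p.@[fun i => (c i).[t]].
Proof.
rewrite mevalE /mmap horner_sum; apply: eq_bigr => m _.
rewrite hornerM hornerC /mmap1 horner_prod; congr (_ * _).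
by apply: eq_bigr => i _; rewrite horner_exp.
Qed.

Lemma size_mmap_affine p :
  exists N, forall c, (forall i, (size (c i) <= 2)%N) ->
    (size (mmap polyC c p) <= N)%N.
Proof.
elim/mpoly_ind: p => [|i p [N IH]||a p q [N IH] [M IHq]].
- by exists 1%N => c _; rewrite rmorph1 size_poly1.
- exists N.+1 => c hc; rewrite rmorphM /= mmapX mmap1U.
  apply: leq_trans (size_polyMleq _ _) _.
  rewrite -subn1 leq_subLR add1n -[N.+2]/(2 + N)%N.
  exact: leq_add (hc i) (IH c hc).
- by exists 0%N => c _; rewrite rmorph0 size_poly0.
- exists (maxn N M) => c hc; rewrite rmorphD /= mmapZ.
  apply: leq_trans (size_polyD _ _) _; rewrite geq_max !leq_max.
  rewrite mul_polyC (leq_trans (size_scale_leq _ _)) ?IH //=.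
  by rewrite IHq // orbT.
Qed.

End MevalCurve.

Section PolyFun.
Variables (n : nat) (F : comNzRingType).
Implicit Types (f g : ('I_n -> F) -> F).

Definition polyfun f := exists p : {mpoly F[n]}, forall v, f v = p.@[v].

Lemma polyfunC c : polyfun (fun=> c).
Proof. by exists c%:MP => v; rewrite mevalC. Qed.

Lemma polyfunX i : polyfun (fun v => v i).
Proof. by exists 'X_i => v; rewrite mevalXU. Qed.

Lemma polyfunD f g : polyfun f -> polyfun g -> polyfun (fun v => f v + g v).
Proof. by move=> [p fp] [q gq]; exists (p + q) => v; rewrite mevalD fp gq. Qed.

Lemma polyfunM f g : polyfun f -> polyfun g -> polyfun (fun v => f v * g v).
Proof. by move=> [p fp] [q gq]; exists (p * q) => v; rewrite mevalM fp gq. Qed.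

Lemma polyfun_sum (I : Type) (r : seq I) (f : I -> ('I_n -> F) -> F) :
  (forall i, polyfun (f i)) -> polyfun (fun v => \sum_(i <- r) f i v).
Proof.
move=> pf; elim: r => [|i r IH].
  by have [p hp] := polyfunC 0; exists p => v; rewrite big_nil -hp.
by have [p hp] := polyfunD (pf i) IH; exists p => v; rewrite big_cons -hp.
Qed.

Lemma polyfun_horner (q : {poly F}) f :
  polyfun f -> polyfun (fun v => q.[f v]).
Proof.
move=> pf; elim/poly_ind: q => [|q c IH].
  by have [p hp] := polyfunC 0; exists p => v; rewrite horner0 -hp.
have [p hp] := polyfunD (polyfunM IH pf) (polyfunC c).
by exists p => v; rewrite hornerMXaddC -hp.
Qed.

End PolyFun.

Lemma polyfun_comp n k (F : comNzRingType) (f : ('I_n -> F) -> F)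
    (u : 'I_n -> ('I_k -> F) -> F) :
  polyfun f -> (forall i, polyfun (u i)) ->
  polyfun (fun v => f (fun i => u i v)).
Proof.
move=> [p fp] /choice[q uq]; exists (p \mPo [tuple q i | i < n]) => v.
rewrite comp_mpoly_meval fp; apply: meval_eq => i.
by rewrite tnth_mktuple uq.
Qed.

Section ClosedField.
Variable F : closedFieldType.

(** Lines are irreducible: two conditions, each of which holds somewhere on a
    line, hold together at some point.  All density arguments reduce to this
    by joining two points with a line. *)
Lemma nonroot2 (p q : {poly F}) s t :
  p.[s] != 0 -> q.[t] != 0 -> exists u, p.[u] != 0 /\ q.[u] != 0.
Proof.
move=> ps qt; have : p * q != 0.
  by rewrite mulf_neq0 //; [apply: contraNneq ps|apply: contraNneq qt];
    move=> ->; rewrite horner0.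
move/closed_nonrootP => [u]; rewrite rootE hornerM mulf_eq0 negb_or.
by case/andP; exists u.
Qed.

Lemma poly_eq_nonroot (q a b : {poly F}) : q != 0 ->
  (forall u, q.[u] != 0 -> a.[u] = b.[u]) -> a = b.
Proof.
move=> q0 ab; apply/eqP; rewrite -subr_eq0; apply/negPn/negP => d0.
have /closed_nonrootP[u] : q * (a - b) != 0 by rewrite mulf_neq0.
rewrite rootE hornerM mulf_eq0 negb_or => /andP[/ab e].
by rewrite hornerD hornerN e subrr eqxx.
Qed.

Lemma closed_field_nat_inj : exists x : nat -> F, injective x.
Proof.
(* Each new value avoids the roots of the product of X - y over the old values
   y. *)
have ex (s : seq F) : exists x, x \notin s.
  have : \prod_(y <- s) ('X - y%:P) != 0 by rewrite monic_neq0 ?monic_prod_XsubC.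
  by case/closed_nonrootP => x; rewrite root_prod_XsubC; exists x.
have [c cP] := choice ex.
pose s := fix s n := if n is n'.+1 then c (s n') :: s n' else [::].
have sS m n : (m < n)%N -> c (s m) \in s n.
  elim: n => // n IH; rewrite ltnS leq_eqVlt => /predU1P[->|/IH mn].
    by rewrite mem_head.
  by rewrite in_cons mn orbT.
have neq m n : (m < n)%N -> c (s m) <> c (s n).
  by move=> /sS mn e; move: (cP (s n)); rewrite -e mn.
exists (c \o s) => m n /= e.
by case: (ltngtP m n) => // /neq; rewrite e.
Qed.

Definition locally_fraction n (f : ('I_n -> F) -> F) := forall v,
  exists p q : {mpoly F[n]}, q.@[v] != 0 /\
    forall u, q.@[u] != 0 -> f u = p.@[u] / q.@[u].

Definition locally_fraction1 (f : F -> F) := forall t,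
  exists p q : {poly F}, q.[t] != 0 /\
    forall u, q.[u] != 0 -> f u = p.[u] / q.[u].

(** If q has a root t0, a fraction that represents f near t0 shows that p also
    vanishes at t0, and a common linear factor can be removed.  Repeating this
    makes q constant.  The bound on the degree feeds the interpolation in
    several variables. *)
Lemma locally_fraction1_poly f (p q : {poly F}) :
  locally_fraction1 f -> q != 0 ->
  (forall u, q.[u] != 0 -> f u = p.[u] / q.[u]) ->
  exists g : {poly F}, (size g <= size p)%N /\ forall u, f u = g.[u].
Proof.
move=> ff; move sq: (size q) => k; elim: k p q sq => [|k IH] p q sq q0 fq.
  by move/eqP: sq; rewrite size_poly_eq0 (negPf q0).
have [/size1_polyC|q1] := leqP (size q) 1.
  move: (q`_0) => c qc; rewrite qc polyC_eq0 in q0.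
  exists (c^-1 *: p); split=> [|u]; first exact: size_scale_leq.
  by rewrite fq qc hornerC // hornerZ mulrC.
have /closed_rootP[t0 qt0] : size q != 1%N by rewrite neq_ltn q1 orbT.
have [p0 [r0 [rt0 fr]]] := ff t0.
have r00 : r0 != 0 by apply: contraNneq rt0 => ->; rewrite horner0.
have e : p * r0 = p0 * q.
  apply: (@poly_eq_nonroot (q * r0)); first by rewrite mulf_neq0.
  move=> u; rewrite hornerM mulf_eq0 negb_or => /andP[qu ru].
  rewrite !hornerM; move: (fq u qu); rewrite (fr u ru) => /eqP.
  by rewrite eqr_div // => /eqP ->.
have pt0 : root p t0.
  move: (congr1 (horner ^~ t0) e); rewrite !hornerM (rootP qt0) mulr0.
  by move/eqP; rewrite mulf_eq0 (negPf rt0) orbF.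
have [p' pE] := factor_theorem _ _ pt0.
have [q' qE] := factor_theorem _ _ qt0.
have X0 : 'X - t0%:P != 0 by rewrite polyXsubC_eq0.
have q'0 : q' != 0 by apply: contraNneq q0; rewrite qE => ->; rewrite mul0r.
have e' : p' * r0 = p0 * q'.
  by apply: (mulIf X0); rewrite mulrAC -pE e qE mulrA.
have [||g [sg gf]] := IH p' q' _ q'0.
- by move: sq; rewrite qE size_Mmonic ?monicXsubC // size_XsubC addn2 => -[].
- move=> u; have [-> q't|ut0 q'u] := eqVneq u t0.
    rewrite (fr _ rt0); apply/eqP; rewrite eqr_div // -!hornerM.
    by rewrite -e' .
  have qu : q.[u] != 0.
    by rewrite qE hornerM mulf_neq0 // hornerXsubC subr_eq0.
  rewrite (fq _ qu) pE qE !hornerM -mulf_div divff ?mulr1 //.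
  by rewrite hornerXsubC subr_eq0.
exists g; split=> //; apply: leq_trans sg _.
have [->|p'0] := eqVneq p' 0; first by rewrite size_poly0.
by rewrite pE size_Mmonic ?monicXsubC // size_XsubC addn2 leqnSn.
Qed.

Lemma mpoly_on_line n (u v : 'I_n -> F) (p : {mpoly F[n]}) :
  exists q : {poly F}, forall t, q.[t] = p.@[fun i => u i + t * (v i - u i)].
Proof.
exists (mmap polyC (fun i => (u i)%:P + 'X * (v i - u i)%:P) p) => t.
rewrite horner_mmap; apply: meval_eq => i.
by rewrite hornerD hornerM hornerX !hornerC.
Qed.

(** Near a given point v, f is a fraction; on the line from v to v0 the
    equality holds at all but finitely many points, hence at v. *)
Lemma locally_fraction_dense n (f : ('I_n -> F) -> F) (g q : {mpoly F[n]}) v0 :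
  locally_fraction f -> q.@[v0] != 0 ->
  (forall v, q.@[v] != 0 -> f v = g.@[v]) -> forall v, f v = g.@[v].
Proof.
move=> ff q0 fg v; have [p [r [rv fr]]] := ff v.
have [P PE] := mpoly_on_line v v0 (g * r - p).
have [Q QE] := mpoly_on_line v v0 (q * r).
have [q' q'E] := mpoly_on_line v v0 q; have [r' r'E] := mpoly_on_line v v0 r.
have line0 : (fun i => v i + 0 * (v0 i - v i)) = v.
  by apply: funext => i; rewrite mul0r addr0.
have line1 : (fun i => v i + 1 * (v0 i - v i)) = v0.
  by apply: funext => i; rewrite mul1r addrC subrK.
have [||s [q's r's]] := @nonroot2 q' r' 1 0.
- by rewrite q'E line1.
- by rewrite r'E line0.
have Q0 : Q != 0.
  apply: contra_neq q's => Q0; move: (QE s); rewrite Q0 horner0 mevalM -q'E -r'E.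
  by move/esym/eqP; rewrite mulf_eq0 (negPf r's) orbF => /eqP.
have P0 : P = 0.
  apply: (poly_eq_nonroot Q0) => t; rewrite QE mevalM mulf_eq0 negb_or.
  case/andP => qt rt; rewrite horner0 PE mevalB mevalM -fg // fr // divfK //.
  by rewrite subrr.
move: (PE 0); rewrite P0 horner0 line0 mevalB mevalM fr // => /esym/eqP.
by rewrite subr_eq0 => /eqP <-; rewrite mulfK.
Qed.

Section Cons.
Variables (T : Type) (n : nat).

Definition vcons (t : T) (w : 'I_n -> T) : 'I_n.+1 -> T :=
  fun i => oapp w t (unlift ord0 i).

Lemma vcons0 t w : vcons t w ord0 = t.
Proof. by rewrite /vcons unlift_none. Qed.

Lemma vconsS t w j : vcons t w (lift ord0 j) = w j.
Proof. by rewrite /vcons liftK. Qed.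

Lemma vcons_eta v : vcons (v ord0) (fun j => v (lift ord0 j)) = v.
Proof.
by apply: funext => i; case: (unliftP ord0 i) => [j|] ->;
  rewrite ?vconsS ?vcons0.
Qed.

End Cons.

(** This is the statement that the regular functions on affine space are the
    polynomials.  Instead of the Nullstellensatz or factoriality it uses
    induction on n: restricted to a generic line in the direction of the first
    variable, f is a polynomial of degree at most some N independent of the
    line, so it is the Lagrange interpolation of its values on N + 1 parallel
    hyperplanes, and those are polynomial by induction. *)
Theorem locally_fraction_polyfun n (f : ('I_n -> F) -> F) :
  locally_fraction f -> polyfun f.
Proof.
elim: n f => [|n IH] f ff.
  have [p hp] := polyfunC 0 (f (fun=> 0)); exists p => v.
  by rewrite -hp; congr f; apply: funext => -[].
have slice c : polyfun (fun w => f (vcons c w)).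
  apply: IH => w; have [p [q [qw fpq]]] := ff (vcons c w).
  pose s := [tuple oapp (fun j => 'X_j) c%:MP (unlift ord0 i) | i < n.+1]
    : n.+1.-tuple {mpoly F[n]}.
  have sE r u : (r \mPo s).@[u] = r.@[vcons c u].
    rewrite comp_mpoly_meval; apply: meval_eq => i; rewrite tnth_mktuple /vcons.
    by case: (unlift _ i) => [j|] /=; rewrite ?mevalXU ?mevalC.
  by exists (p \mPo s), (q \mPo s); rewrite sE; split=> // u; rewrite !sE; exact: fpq.
have [p [q [q0 fpq]]] := ff (fun=> 0).
have [N sizeN] := size_mmap_affine p.
have [x x_inj] := closed_field_nat_inj.
pose L (i : 'I_N.+1) : {poly F} := tnth (lagrange N.+1 x) i.
have [g gE] : polyfun (fun v : 'I_n.+1 -> F => \sum_(i < N.+1)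
    f (vcons (x i) (fun j => v (lift ord0 j))) * (L i).[v ord0]).
  apply: polyfun_sum => i; apply: polyfunM.
    apply: (polyfun_comp (slice (x i)) (u := fun j v => v (lift ord0 j))) => j.
    exact: polyfunX.
  exact/polyfun_horner/polyfunX.
pose c w : 'I_n.+1 -> {poly F} := vcons 'X (polyC \o w).
have cE r w t : (mmap polyC (c w) r).[t] = r.@[vcons t w].
  rewrite horner_mmap; apply: meval_eq => i; rewrite /c /vcons.
  by case: (unlift _ i) => [j|] /=; rewrite ?hornerC ?hornerX.
(* The interpolation agrees with f on every line on which q is not identically
   0. *)
exists g; apply: (locally_fraction_dense ff q0) => v.
rewrite -[v]vcons_eta; set w := (X in vcons _ X); move: (v ord0) => t qt.
have qw0 : mmap polyC (c w) q != 0.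
  by apply: contra_neq qt => qw0; rewrite -cE qw0 horner0.
have [||h [sh fh]] := @locally_fraction1_poly (fun s => f (vcons s w))
    (mmap polyC (c w) p) (mmap polyC (c w) q) _ qw0.
- move=> s; have [p' [q' [q'w fpq']]] := ff (vcons s w).
  exists (mmap polyC (c w) p'), (mmap polyC (c w) q'); rewrite cE; split=> // u.
  by rewrite !cE; exact: fpq'.
- by move=> u; rewrite !cE; exact: fpq.
have hN : (size h <= N.+1)%N.
  apply: leq_trans sh (leqW (sizeN _ _)) => i; rewrite /c /vcons.
  by case: (unlift _ i) => [j|] /=; rewrite ?size_polyX // size_polyC; case: eqP.
rewrite -gE vcons0 fh (lagrange_gen (x := x) _ _ hN) // horner_sum.
apply: eq_bigr => i _; rewrite hornerM hornerC -fh; congr (f (vcons _ _) * _).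
by apply: funext => j; rewrite vconsS.
Qed.

(** Comparing the coefficients of al^e on both sides of the homogeneity
    relation, for a fixed v, discards the monomials of the wrong weight. *)
Lemma weight_filter n (s : seq 'X_{1..n}) (c : 'X_{1..n} -> F) (P : pred 'X_{1..n})
    (wt : 'I_n -> nat) e (g : ('I_n -> F) -> F) :
  (forall v, g v = \sum_(m <- s | P m) c m * \prod_i v i ^+ m i) ->
  (forall al v, al != 0 -> g (fun i => al ^+ wt i * v i) = al ^+ e * g v) ->
  forall v, g v =
    \sum_(m <- s | P m && (\sum_i wt i * m i == e)%N) c m * \prod_i v i ^+ m i.
Proof.
move=> gE gh v.
pose p := \sum_(m <- s | P m) (c m * \prod_i v i ^+ m i) *: 'X^(\sum_i wt i * m i) : {poly F}.
have pE : p = g v *: 'X^e.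
  apply: (@poly_eq_nonroot 'X); first by rewrite polyX_eq0.
  move=> al; rewrite hornerX => al0.
  rewrite hornerZ hornerXn [RHS]mulrC -gh // gE horner_sum; apply: eq_bigr => m _.
  rewrite hornerZ hornerXn -mulrA; congr (_ * _).
  rewrite -prodrXr mulrC -big_split; apply: eq_bigr => i _.
  by rewrite exprMn exprM.
have := congr1 (fun q : {poly F} => q`_e) pE.
rewrite coefZ coefXn eqxx mulr1 => <-; rewrite coef_sum big_mkcondr.
apply: eq_bigr => m _; rewrite coefZ coefXn [e == _]eq_sym.
by case: eqP; rewrite ?mulr1 ?mulr0.
Qed.

End ClosedField.

(** * The projective spectrum of an algebra generated in degree one *)

Section ProjectivePoints.
Variables (F : fieldType) (I : finType).
Implicit Types (P Q : {mpoly F[#|I|]}) (L M : line F I) (u v z : coord_vec F I).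

Lemma hevalM P Q v : heval (P * Q) v = heval P v * heval Q v.
Proof. exact: mevalM. Qed.

Lemma heval_lin c P Q v : heval (c *: P + Q) v = c * heval P v + heval Q v.
Proof. by rewrite /heval mevalD mevalZ. Qed.

Lemma hevalX i v : heval 'X_(enum_rank i) v = v i.
Proof. by rewrite /heval mevalXU enum_rankK. Qed.

Lemma heval_scale d P c v : P \is d.-homog -> heval P (c *: v) = c ^+ d * heval P v.
Proof.
move: d P; apply: dhomog_ind => [|d i p IH|d|d a p q IHp IHq].
- by rewrite expr0 mul1r /heval !meval1.
- rewrite !hevalM IH exprS /heval !mevalXU ffunE /=.
  by rewrite /GRing.scale /= -!mulrA; congr (_ * _); rewrite mulrCA.
- by rewrite /heval !meval0 mulr0.
- by rewrite !heval_lin IHp IHq mulrDr mulrCA.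
Qed.

Lemma homog1_linear P : P \is 1.-homog ->
  exists c : {ffun I -> F}, forall z, heval P z = \sum_i c i * z i.
Proof.
suff h d Q : Q \is d.-homog -> (d = 0%N -> exists c, forall z, heval Q z = c) /\
    (d = 1%N -> exists c : {ffun I -> F}, forall z, heval Q z = \sum_i c i * z i).
  by move=> /h[_]; exact.
move: d Q; apply: dhomog_ind => [|d i q [IH _]|d|d a q r [q0 q1] [r0 r1]].
- by split=> // _; exists 1 => z; rewrite /heval meval1.
- split=> // -[/IH[c cE]]; exists [ffun j => (j == enum_val i)%:R * c] => z.
  rewrite (bigD1 (enum_val i)) //= big1 ?addr0 => [|j /negPf ji].
    by rewrite hevalM cE ffunE eqxx mul1r mulrC /heval mevalXU.
  by rewrite ffunE ji !mul0r.
- split=> _; first by exists 0 => z; rewrite /heval meval0.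
  exists [ffun=> 0] => z; rewrite /heval meval0 big1 // => i _.
  by rewrite ffunE mul0r.
- split=> d1.
    have [c cE] := q0 d1; have [e eE] := r0 d1.
    by exists (a * c + e) => z; rewrite heval_lin cE eE.
  have [c cE] := q1 d1; have [e eE] := r1 d1.
  exists [ffun i => a * c i + e i] => z; rewrite heval_lin cE eE mulr_sumr -big_split.
  by apply: eq_bigr => i _; rewrite ffunE /= mulrDl mulrA.
Qed.

Lemma coord_neq0 v : v != 0 -> exists i, v i != 0.
Proof.
move=> v0; apply: contrapT => /forallNP z; case/eqP: v0; apply/ffunP => i.
by rewrite ffunE; apply/eqP/negPn/negP.
Qed.

Lemma dim_vline1 v : v != 0 -> \dim <[v]> == 1%N.
Proof. by move=> v0; rewrite dim_vline v0. Qed.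

Definition line_through v (v0 : v != 0) : line F I := exist _ <[v]>%VS (dim_vline1 v0).

Lemma line_neq0 L : exists2 z, z \in val L & z != 0.
Proof.
have L0 : val L != 0%VS by rewrite -dimv_eq0 (eqP (valP L)).
by exists (vpick (val L)); rewrite ?memv_pick // vpick0.
Qed.

Lemma line_genP L z : z \in val L -> z != 0 -> val L = <[z]>%VS.
Proof.
move=> zL z0; apply/esym/eqP; rewrite eqEdim -memvE zL (eqP (valP L)).
by rewrite dim_vline z0.
Qed.

Lemma line_eqP L M z : z \in val L -> z \in val M -> z != 0 -> L = M.
Proof.
by move=> zL zM z0; apply: val_inj; rewrite (line_genP zL z0) (line_genP zM z0).
Qed.

Lemma vanishesP d P L z : P \is d.-homog -> z \in val L -> z != 0 ->
  vanishes P L <-> heval P z = 0.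
Proof.
move=> hP zL z0; split=> [|Pz v]; first exact.
rewrite (line_genP zL z0) => /vlineP[k ->].
by rewrite (heval_scale _ _ hP) Pz mulr0.
Qed.

End ProjectivePoints.

Section GeneratedInDegreeOne.
Variables (F : fieldType) (V : Type) (J : finType) (A : graded F V).
Variables (s : J -> V -> F) (D : set V).

(** Sections of a line bundle on a cone D are extended by 0, so a form in the
    sections has to be cut off outside D as well; this only matters in degree
    0, where the unit of the algebra is the indicator of D. *)
Definition section_eval (G : {mpoly F[#|J|]}) : V -> F :=
  fun x => if `[< D x >] then heval G [ffun j => s j x] else 0.

Local Notation ev := section_eval.

Hypothesis s_off : forall j x, ~ D x -> s j x = 0.
Hypothesis A_gen : forall m f, A m f <-> exists2 G, G \is m.-homog & f = ev G.

Lemma section_evalM G H : ev (G * H) = fun x => ev G x * ev H x.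
Proof.
by apply: funext => x; rewrite /ev; case: asbool; rewrite ?hevalM ?mulr0.
Qed.

Lemma section_eval_lin c G H : ev (c *: G + H) = fun x => c * ev G x + ev H x.
Proof.
by apply: funext => x; rewrite /ev; case: asbool; rewrite ?heval_lin ?mulr0 ?addr0.
Qed.

Lemma section_eval0 : ev 0 = fun=> 0.
Proof. by apply: funext => x; rewrite /ev /heval meval0; case: asbool. Qed.

Lemma section_evalX j : ev 'X_(enum_rank j) = s j.
Proof.
apply: funext => x; rewrite /ev hevalX ffunE.
by case: (asboolP (D x)) => // /s_off.
Qed.

Lemma section_eval_in m G : G \is m.-homog -> A m (ev G).
Proof. by move=> hG; apply/A_gen; exists G. Qed.

Lemma dhomogXi (i : 'I_#|J|) : ('X_i : {mpoly F[#|J|]}) \is 1.-homog.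
Proof. by rewrite dhomogX /= mdeg1. Qed.

Lemma generator_in j : A 1%N (s j).
Proof. by rewrite -section_evalX; apply/section_eval_in/dhomogXi. Qed.

(** p is the homogeneous ideal of the point L in A. *)
Definition ideal_of_line (p : graded F V) (L : line F J) :=
  forall z, z \in val L -> z != 0 -> forall m G, G \is m.-homog ->
    p m (ev G) <-> heval G z = 0.

Section Point.
Variable p : graded F V.
Hypothesis pP : is_proj_point A p.

(** Otherwise p contains all the generators, hence everything of positive
    degree. *)
Lemma proj_point_section : exists j, ~ p 1%N (s j).
Proof.
apply: contrapT => /forallNP pall.
have [m [f [m0 Af []]]] := pp_relevant pP.
case/A_gen: Af => G hG ->.
suff /(_ m G hG) [_] : forall d G, G \is d.-homog -> G \is d.-homog /\
  ((0 < d)%N -> p d (ev G)) by exact.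
apply: dhomog_ind => [|d i q [hq pq]|d|d c q r [hq pq] [hr pr]].
- by split=> //; exact: dhomog1.
- split=> [|_]; first by rewrite -[d.+1]/(1 + d)%N dhomogM // dhomogXi.
  rewrite mulrC section_evalM -addn1; apply: (pp_ideal pP); first exact: section_eval_in.
  by rewrite -(enum_valK i) section_evalX; apply: contrapT; exact: pall.
- by split=> [|_]; [exact: dhomog0|rewrite section_eval0; exact: (pp_zero pP)].
- split=> [|d0]; first by rewrite dhomogD // dhomogZ.
  by rewrite section_eval_lin; apply: pp_lin pP _ _ _ _ (pq d0) (pr d0).
Qed.

(** The homogeneous coordinates of p are the residues c_j of s_j / s_j0 for a
    generator s_j0 outside p.  Modulo p, a form G in the s_j is G(c) times a
    power of s_j0, so it lies in p exactly if G(c) = 0. *)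
Lemma proj_point_line : exists L, ideal_of_line p L.
Proof.
have [j0 pj0] := proj_point_section.
have /choice[c pc] j : exists c, p 1%N (fun x => s j x - c * s j0 x).
  exact: (pp_residue pP (generator_in j) (generator_in j0)).
pose z : coord_vec F J := [ffun j => c j].
pose t d := ev ('X_(enum_rank j0) ^+ d).
have tS d x : t d.+1 x = s j0 x * t d x by rewrite /t exprS section_evalM section_evalX.
(* Modulo p, each s_j may be replaced by c_j s_j0. *)
have pG : forall d G, G \is d.-homog ->
    p d (fun x => ev G x - heval G z * t d x) /\ G \is d.-homog.
  apply: dhomog_ind => [|d i q [pq hq]|d|d a q r [pq hq] [pr hr]].
  - split; last exact: dhomog1.
    rewrite [X in p _ X](_ : _ = fun=> 0); first exact: (pp_zero pP).
    by apply: funext => x; rewrite /t expr0 /heval meval1 mul1r subrr.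
  - split; last by rewrite -[d.+1]/(1 + d)%N dhomogM // dhomogXi.
    rewrite -(enum_valK i) hevalM section_evalM section_evalX hevalX ffunE.
    move: (enum_val i) (heval q z) pq => j b pq.
    rewrite [X in p _ X](_ : _ = fun x =>
      b * (t d x * (s j x - c j * s j0 x)) + s j x * (ev q x - b * t d x)).
      apply: (pp_lin pP); last exact: pp_ideal pP _ _ _ _ (generator_in j) pq.
      rewrite -addn1; apply: pp_ideal pP _ _ _ _ _ (pc j).
      by apply: section_eval_in; rewrite -[d in d.-homog]mul1n dhomogMn // dhomogXi.
    by apply: funext => x; rewrite tS; ring.
  - split; last exact: dhomog0.
    rewrite [X in p _ X](_ : _ = fun=> 0); first exact: (pp_zero pP).
    by apply: funext => x; rewrite section_eval0 /heval meval0 mul0r subr0.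
  - split; last by rewrite dhomogD // dhomogZ.
    rewrite [X in p _ X](_ : _ = fun x =>
      a * (ev q x - heval q z * t d x) + (ev r x - heval r z * t d x)).
      exact: pp_lin pP _ _ _ _ pq pr.
    by apply: funext => x; rewrite section_eval_lin heval_lin; ring.
have At d : A d (t d).
  by apply: section_eval_in; rewrite -[d in d.-homog]mul1n dhomogMn // dhomogXi.
have pt d : ~ p d (t d).
  elim: d => [|d IH] ptd.
    apply: pj0; move: (pp_ideal pP (generator_in j0) ptd).
    rewrite [X in p _ X](_ : _ = s j0) //.
    by rewrite /t expr0 -section_evalX -section_evalM mulr1.
  have : p (1 + d)%N (fun x => s j0 x * t d x).
    by rewrite add1n; congr (p _ _): ptd; apply: funext => x; rewrite tS.
  by case/(pp_prime pP (generator_in j0) (At d)).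
have main d G : G \is d.-homog -> p d (ev G) <-> heval G z = 0.
  move=> hG; have [pGz _] := pG d G hG; split=> [pe|Gz]; last first.
    congr (p _ _): pGz; apply: funext => x; by rewrite Gz mul0r subr0.
  apply: contrapT => /eqP Gz; apply: (pt d).
  have := pp_lin pP (- (heval G z)^-1) pGz (pp_lin pP ((heval G z)^-1) pe (pp_zero pP d)).
  congr (p _ _); apply: funext => x; rewrite addr0 mulrBr !mulNr opprK mulrA.
  by rewrite mulVf // mul1r addrAC addNr add0r.
have zj0 : z != 0.
  apply/eqP => z0; apply: pj0; rewrite -section_evalX; apply/main; first exact: dhomogXi.
  by rewrite hevalX z0 ffunE.
exists (line_through zj0) => w /= /vlineP[k ->].
rewrite scaler_eq0 negb_or => /andP[k0 _] m G hG.
rewrite main // (heval_scale _ _ hG); split=> [->|/eqP]; first by rewrite mulr0.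
by rewrite mulf_eq0 expf_eq0 (negPf k0) andbF => /eqP.
Qed.
End Point.

Lemma cross_homog (a b : F) (i j : J) :
  (a *: 'X_(enum_rank j) + - b *: 'X_(enum_rank i) : {mpoly F[#|J|]}) \is 1.-homog.
Proof. by rewrite dhomogD // dhomogZ // dhomogXi. Qed.

Lemma heval_cross (a b : F) i j (z : coord_vec F J) :
  heval (a *: 'X_(enum_rank j) + - b *: 'X_(enum_rank i)) z = a * z j - b * z i.
Proof. by rewrite heval_lin /heval mevalZ -!/(heval _ z) !hevalX mulNr. Qed.

Lemma section_eval_cross (a b : F) i j :
  ev (a *: 'X_(enum_rank j) + - b *: 'X_(enum_rank i)) =
    fun x => a * s j x - b * s i x.
Proof.
rewrite section_eval_lin -(addr0 (- b *: _)) section_eval_lin !section_evalX section_eval0.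
by apply: funext => x; rewrite addr0 mulNr.
Qed.

(** The forms z_i X_j - z_j X_i recover the line from its ideal. *)
Lemma ideal_of_line_unique p L M :
  ideal_of_line p L -> ideal_of_line p M -> L = M.
Proof.
move=> pL pM; have [z zL z0] := line_neq0 L; have [w wM w0] := line_neq0 M.
have zw i j : z i * w j = z j * w i.
  apply/eqP; rewrite -subr_eq0 -heval_cross; apply/eqP.
  apply/(pM w wM w0 1%N); first exact: cross_homog.
  apply/(pL z zL z0); first exact: cross_homog.
  by rewrite heval_cross mulrC subrr.
have [i zi] := coord_neq0 z0.
apply: (line_eqP (z := w)) => //.
rewrite (line_genP zL z0); apply/vlineP; exists (w i / z i); apply/ffunP => j.
by rewrite ffunE /= /GRing.scale /= mulrAC [w i * _]mulrC -zw mulrAC divff // mul1r.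
Qed.

Lemma ideal_of_line_eq (p q : proj_point A) L :
  ideal_of_line p L -> ideal_of_line q L -> p = q.
Proof.
move=> pL qL; have [z zL z0] := line_neq0 L.
have e : ideal_of p = ideal_of q.
  apply: funext => m; apply: funext => f; apply: propext.
  split=> [pf|qf].
    have /A_gen[G hG fG] := pp_sub (ideal_ofP p) pf.
    by move: pf; rewrite fG => /(pL z zL z0 _ _ hG) /(qL z zL z0 _ _ hG).
  have /A_gen[G hG fG] := pp_sub (ideal_ofP q) qf.
  by move: qf; rewrite fG => /(qL z zL z0 _ _ hG) /(pL z zL z0 _ _ hG).
case: p q e {pL qL} => p pP [q qP] /= e; subst q; congr ProjPoint.
exact: Prop_irrelevance.
Qed.

Definition kernel_locus : set (pspace F J) :=
  [set L | forall m G, G \is m.-homog -> ev G = (fun=> 0) -> vanishes G (L : line F J)].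

Lemma ideal_of_line_kernel p L : is_proj_point A p ->
  ideal_of_line p L -> kernel_locus L.
Proof.
move=> pP pL m G hG G0; have [z zL z0] := line_neq0 L.
apply/(vanishesP hG zL z0)/(pL z zL z0 _ _ hG); rewrite G0.
exact: (pp_zero pP).
Qed.

(** Since the relations among the s_j vanish at L, a form can be evaluated at L
    through the element of A that it represents; the elements that evaluate to
    0 are the required prime ideal. *)
Lemma kernel_locus_point L : kernel_locus L ->
  exists p : proj_point A, ideal_of_line p L.
Proof.
move=> LZ; have [z zL z0] := line_neq0 L.
pose p : graded F V := fun m f =>
  exists G, [/\ G \is m.-homog, f = ev G & heval G z = 0].
have pE m G : G \is m.-homog -> p m (ev G) <-> heval G z = 0.
  move=> hG; split=> [[H [hH GH Hz]]|Gz]; last by exists G.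
  have : heval (-1 *: H + G) z = 0.
    apply: (LZ m) => //; first by rewrite dhomogD // dhomogZ.
    by rewrite section_eval_lin -GH; apply: funext => x; rewrite mulN1r addNr.
  by rewrite heval_lin Hz mulr0 add0r.
have pP : is_proj_point A p.
  split.
  - by move=> m _ [G [hG -> _]]; exact: section_eval_in.
  - by move=> m; exists 0; rewrite dhomog0 section_eval0 /heval meval0.
  - move=> m c _ _ [G [hG -> Gz]] [H [hH -> Hz]]; rewrite -section_eval_lin.
    by apply/pE; rewrite ?heval_lin ?Gz ?Hz ?mulr0 ?addr0 // dhomogD // dhomogZ.
  - move=> n m _ _ /A_gen[G hG ->] [H [hH -> Hz]]; rewrite -section_evalM.
    by apply/pE; rewrite ?hevalM ?Hz ?mulr0 // dhomogM.
  - move=> n m _ _ /A_gen[G hG ->] /A_gen[H hH ->]; rewrite -section_evalM.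
    move/pE; rewrite dhomogM // hevalM => /(_ isT)/eqP; rewrite mulf_eq0.
    by case/orP => /eqP ?; [left|right]; apply/pE.
  - have [j zj] := coord_neq0 z0.
    exists 1%N, (s j); split=> //; first exact: generator_in.
    by rewrite -section_evalX => /pE; rewrite dhomogXi hevalX => /(_ isT)/eqP; rewrite (negPf zj).
  - move=> m _ _ /A_gen[G hG ->] /A_gen[H hH ->] pH.
    exists (heval G z / heval H z).
    rewrite [X in p _ X](_ : _ = ev (- (heval G z / heval H z) *: H + G)); last first.
      by rewrite section_eval_lin; apply: funext => x; rewrite mulNr addrC.
    apply/pE; first by rewrite dhomogD // dhomogZ.
    rewrite heval_lin mulNr divfK ?addNr //.
    by apply: contra_notN pH => /eqP ?; apply/pE.
exists (ProjPoint pP) => w wL w0 m G hG /=.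
by rewrite pE // -(vanishesP hG zL z0) (vanishesP hG wL w0).
Qed.

(** Both sides are described by forms: an element of A of degree m is a form in
    the s_j, and it lies in the ideal p exactly if that form vanishes at the
    point h p.  This translates points, open sets and fractions. *)
Theorem proj_embedding : exists h : Proj A -> pspace F J,
  given_by_sections s h /\ embedding_onto h kernel_locus.
Proof.
have /choice[h hP] (p : proj_point A) : exists L : line F J, ideal_of_line p L.
  exact/proj_point_line/ideal_ofP.
have hE (p : proj_point A) m G : G \is m.-homog ->
    ~ ideal_of p m (ev G) <-> ~ vanishes G (h p).
  move=> hG; have [z zL z0] := line_neq0 (h p).
  by rewrite (vanishesP hG zL z0) (hP p z zL z0 _ _ hG).
have hrange (L : line F J) : kernel_locus L -> exists p, h p = L.
  move=> /kernel_locus_point[p pL]; exists p.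
  exact: ideal_of_line_unique (hP p) pL.
exists h; split.
  move=> p; split; first exact: proj_point_section (ideal_ofP p).
  move=> z zL i j; rewrite -section_eval_cross.
  have [w wL w0] := line_neq0 (h p).
  apply/(hP p w wL w0); first exact: cross_homog.
  move: zL; rewrite (line_genP wL w0) => /vlineP[k ->].
  by rewrite heval_cross !ffunE /= /GRing.scale /= mulrAC subrr.
split.
- by move=> p q pq; apply: (ideal_of_line_eq (hP p)); rewrite pq; exact: hP.
- apply/seteqP; split=> [_ [p _ <-]|L /hrange[p <-]]; last by exists p.
  exact: ideal_of_line_kernel (ideal_ofP p) (hP p).
- move=> U; split=> [[S SA ->]|[_ [S Sh ->] ->]].
    exists [set L : line F J | exists2 G, (exists m, G \is m.-homog /\ S m (ev G))
        & ~ vanishes G L].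
      by exists (fun G => exists m, G \is m.-homog /\ S m (ev G)) => // G [m []]; exists m.
    apply/seteqP; split=> p /=.
      move=> [m [f [Sf pf]]]; have /A_gen[G hG fG] := SA _ _ Sf.
      by exists G; [exists m; rewrite -fG|apply/(hE p m G hG); rewrite -fG].
    by move=> [G [m [hG SG]] /(hE p m G hG) pG]; exists m, (ev G).
  exists (fun m => [set f | exists G, [/\ S G, G \is m.-homog & f = ev G]]).
    by move=> m _ [G [_ hG ->]]; exact: section_eval_in.
  apply/seteqP; split=> p /=.
    move=> [G SG pG]; have [m hG] := Sh _ SG; exists m, (ev G).
    by split; [exists G|apply/(hE p m G hG)].
  by move=> [m [_ [[G [SG hG ->]] /(hE p m G hG)]]]; exists G.
- move=> U phi _; split=> [reg y Up /hrange[p Ep]|reg p Up].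
  + rewrite -Ep in Up *; have [m [f [g [Af Ag pg fg]]]] := reg p Up.
    move: Af Ag pg fg => /A_gen[G hG ->] /A_gen[H hH ->] pH fg.
    have /choice[z zP] (M : line F J) : exists z : coord_vec F J, z \in val M /\ z != 0.
      by have [z] := line_neq0 M; exists z.
    pose psi (M : line F J) := heval G (z M) / heval H (z M).
    exists [set M : line F J | ~ vanishes H M], psi; split.
    * exists [set H] => [_ ->|]; first by exists m.
      by apply/seteqP; split=> M /=; [exists H|move=> [_ -> ]].
    * exact: (hE p m H hH).1 pH.
    * move=> L HL; exists m, G, H; split=> // M v HM vM Hv; rewrite /psi.
      have [zM zM0] := zP M; move: vM Hv; rewrite (line_genP zM zM0).
      move=> /vlineP[k ->]; rewrite (heval_scale k _ hG) (heval_scale k _ hH).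
      rewrite mulf_eq0 negb_or => /andP[km _].
      by rewrite -mulf_div divff // mul1r.
    * move=> L HL UL /hrange[q Eq]; rewrite -Eq in HL UL *.
      have [zL z0] := zP (h q).
      have Hz : heval H (z (h q)) != 0.
        by apply/eqP => /(vanishesP hH zL z0).
      have /fg : (h @^-1` U) q by []. move=> /(_ ((hE _ _ _ hH).2 HL)).
      rewrite [X in ideal_of q m X](_ : _ = ev (- phi (h q) *: H + G)); last first.
        by rewrite section_eval_lin; apply: funext => x /=; rewrite mulNr addrC.
      have hGH : - phi (h q) *: H + G \is m.-homog by rewrite dhomogD // dhomogZ.
      move=> /(hP q _ zL z0 _ _ hGH); rewrite heval_lin mulNr => /eqP.
      by rewrite addrC subr_eq0 /psi => /eqP ->; rewrite mulfK.
  + have Zp := ideal_of_line_kernel (ideal_ofP p) (hP p).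
    have [W [psi [[S Sh WE] Wp Wpsi eqpsi]]] := reg (h p) Up Zp.
    have [m [P [Q [hGP hQ Qp psiE]]]] := Wpsi _ Wp.
    move: (Wp); rewrite WE => -[K SK Kp]; have [k hK] := Sh _ SK.
    (* The fraction P / Q represents phi on W only.  The points with K <> 0 are
       in W, so after multiplication by K the denominator is zero outside W. *)
    have hom R : R \is m.-homog -> R * K \is (m + k).-homog.
      by move=> hR; rewrite dhomogM.
    have van (M : line F J) : ~ vanishes (Q * K) M <-> ~ vanishes Q M /\ ~ vanishes K M.
      have [z zM z0] := line_neq0 M.
      rewrite (vanishesP (hom _ hQ) zM z0) (vanishesP hQ zM z0) (vanishesP hK zM z0).
      rewrite hevalM; split=> [QK|[/eqP Q0 /eqP K0] /eqP].
        by split=> e0; apply: QK; rewrite e0 ?mul0r ?mulr0.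
      by rewrite mulf_eq0 (negPf Q0) (negPf K0).
    exists (m + k)%N, (ev (P * K)), (ev (Q * K)); split.
    * exact/section_eval_in/hom.
    * exact/section_eval_in/hom.
    * exact/(hE _ _ _ (hom _ hQ))/van.
    * move=> q Uq /(hE _ _ _ (hom _ hQ))/van[Qq Kq].
      have Wq : W (h q) by rewrite WE; exists K.
      have Zq := ideal_of_line_kernel (ideal_ofP q) (hP q).
      have [z zL z0] := line_neq0 (h q).
      have Qz : heval Q z != 0 by apply/eqP => /(vanishesP hQ zL z0).
      rewrite [X in ideal_of q _ X](_ : _ = ev (- phi (h q) *: (Q * K) + P * K)); last first.
        by rewrite section_eval_lin; apply: funext => x /=; rewrite mulNr addrC.
      apply/(hP q z zL z0); first by rewrite dhomogD ?dhomogZ ?hom.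
      rewrite heval_lin !hevalM eqpsi // (psiE (h q) z) // mulNr mulrA divfK //.
      by rewrite addNr.
Qed.

End GeneratedInDegreeOne.

(** * Equations of scrolls *)

Section ScrollKernel.
Variables (F : fieldType) (d : nat) (a : 'I_d -> nat).
Local Notation J := (scroll_index a).

(** The hypothesis says that the matrix with columns (z_{i,k}, z_{i,k+1}) has
    rank at most 1.  If its first row is not zero, all columns are multiples
    of some (1, rho), so each block of z is a geometric progression of ratio
    rho.  Otherwise only the last entry of each block can be nonzero, and the
    parameter is [0 : 1]. *)
Lemma scroll_of_minors (L : line F J) (z : coord_vec F J) : z \in val L -> z != 0 ->
  (forall i j (k : 'I_(a i)) (l : 'I_(a j)),
    z (@Tagged _ i (fun i => 'I_(a i).+1) (widen_ord (leqnSn _) k)) *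
    z (@Tagged _ j (fun i => 'I_(a i).+1) (lift ord0 l)) =
    z (@Tagged _ i (fun i => 'I_(a i).+1) (lift ord0 k)) *
    z (@Tagged _ j (fun i => 'I_(a i).+1) (widen_ord (leqnSn _) l))) ->
  scroll (F := F) (a := a) L.
Proof.
move=> zL z0 minors.
suff [x [y [lam zE]]] : exists x y lam, z = scroll_vec a x y lam.
  by exists x, y, lam; rewrite -zE; exact: line_genP.
pose zz i (k : nat) : F := z (@Tagged _ i (fun i => 'I_(a i).+1) (inord k)).
have zzE u : z u = zz (tag u) (tagged u).
  by rewrite /zz inord_val; case: u.
have mm i j k l : (k < a i)%N -> (l < a j)%N -> zz i k * zz j l.+1 = zz i k.+1 * zz j l.
  move=> ki lj; move: (minors i j (Ordinal ki) (Ordinal lj)).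
  by rewrite !zzE /= /bump /= !add1n.
have [[i0 [k0 [k0a zk0]]]|/forallNP nz] :=
    pselect (exists i k, (k < a i)%N /\ zz i k != 0).
  (* The matrix of the minors has a nonzero entry in its first row. *)
  pose rho := zz i0 k0.+1 / zz i0 k0.
  have zS i k : (k < a i)%N -> zz i k.+1 = rho * zz i k.
    move=> ki; apply: (mulfI zk0); rewrite (mm _ _ _ _ k0a ki) /rho.
    by rewrite mulrA [zz i0 k0 * _]mulrC divfK.
  have zX i k : (k <= a i)%N -> zz i k = zz i 0%N * rho ^+ k.
    elim: k => [|k IH] ki; first by rewrite expr0 mulr1.
    by rewrite zS // IH 1?ltnW // exprS mulrCA.
  exists 1, rho, (fun i => zz i 0%N); apply/ffunP => -[i k].
  by rewrite ffunE zzE /= expr1n mulr1 zX // -ltnS.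
have z0' i k : (k < a i)%N -> zz i k = 0.
  move=> ki; apply/eqP/negPn/negP => nzk; apply: (nz i); by exists k.
(* Here 0 ^+ (a i - k) is 1 if k = a i and 0 otherwise. *)
exists 0, 1, (fun i => zz i (a i)); apply/ffunP => -[i k].
rewrite ffunE zzE /= expr1n mulr1.
have [ki|ki] := ltnP k (a i); first by rewrite z0' // expr0n subn_eq0 leqNgt ki mulr0.
have -> : (k = a i :> nat) by apply/eqP; rewrite eqn_leq ki -ltnS ltn_ord.
by rewrite subnn expr0 mulr1.
Qed.
End ScrollKernel.

Section Free.
Variables (F : closedFieldType) (d : nat) (a : 'I_d -> nat).

(** The parameter [1 : y] with a single nonzero weight separates the blocks and
    gives a polynomial in y that vanishes identically. *)
Lemma scroll_vec_free (c : scroll_index a -> F) :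
  (forall x y lam, \sum_j c j * scroll_vec a x y lam j = 0) -> forall j, c j = 0.
Proof.
move=> c0 [i k].
pose C l : F := c (@Tagged _ i (fun t => 'I_(a t).+1) l).
pose p : {poly F} := \sum_(l < (a i).+1) C l *: 'X^l.
have p0 : p = 0.
  apply: (@poly_eq_nonroot _ 1); first exact: oner_neq0.
  move=> y _; rewrite horner0 -[RHS](c0 1 y (fun t => (t == i)%:R)).
  rewrite horner_sum.
  transitivity (\sum_(t < d) \sum_(l < (a t).+1)
    c (@Tagged _ t (fun t => 'I_(a t).+1) l) * ((t == i)%:R * y ^+ l)).
    rewrite [RHS](bigD1 i) //= [X in _ = _ + X]big1 ?addr0 => [|t /negPf ti].
      by apply: eq_bigr => l _; rewrite eqxx mul1r hornerZ hornerXn.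
    by rewrite big1 // => l _; rewrite ti mul0r mulr0.
  rewrite (sig_big_dep _ (fun=> xpredT) (fun t (l : 'I_(a t).+1) =>
    c (Tagged (fun t => 'I_(a t).+1) l) * ((t == i)%:R * y ^+ l))).
  by apply: eq_big => -[t l] // _; rewrite ffunE /= expr1n mulr1.
have := congr1 (fun q : {poly F} => q`_k) p0; rewrite coef0 coef_sum.
rewrite (bigD1 k) //= coefZ coefXn eqxx mulr1 big1 ?addr0 // => l /negPf lk.
by rewrite coefZ coefXn eq_sym (inj_eq val_inj) lk mulr0.
Qed.
End Free.

(** * Pluecker vectors, orbit closures and invariant sections *)

Section Pluecker.
Variables (r n : nat).
Implicit Types (I J w : incr r n).

Lemma incr_uniq I : uniq (val I).
Proof.
apply: (map_uniq (f := val)); apply: sorted_uniq (valP I).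
  exact: ltn_trans.
exact: ltnn.
Qed.

Lemma incr_inj I : injective (tnth (val I)).
Proof. exact/tuple_uniqP/incr_uniq. Qed.

Lemma incr_sub_eq I J : {subset val I <= val J} -> I = J.
Proof.
move=> sIJ; apply/val_inj/val_inj/(inj_map val_inj).
have [_ eIJ] : (size (val I) = size (val J)) * (val I =i val J).
  by apply: uniq_min_size => //; rewrite ?incr_uniq // !size_tuple.
apply: (irr_sorted_eq ltn_trans ltnn (valP I) (valP J)).
exact: eq_mem_map.
Qed.

Variable F : fieldType.
Implicit Types (M : 'M[F]_(n, r)) (t : 'rV[F]_n) (v : coord_vec F (incr r n)).

Definition pluck M : coord_vec F (incr r n) :=
  [ffun I : incr r n => \det (rowsub (tnth (val I)) M)].

Lemma pluck_mulr M (A : 'M[F]_r) : pluck (M *m A) = \det A *: pluck M.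
Proof.
by apply/ffunP => I; rewrite !ffunE -mul_rowsub_mx det_mulmx mulrC.
Qed.

Lemma wedge_act_e (g : 'M[F]_n) w :
  wedge_act g (e_ F w) = pluck (colsub (tnth (val w)) g).
Proof.
apply/ffunP => I; rewrite !ffunE (bigD1 w) //= ffunE eqxx mulr1.
rewrite big1 ?addr0 => [|J /negPf Jw]; last by rewrite ffunE Jw mulr0.
by congr (\det _); apply/matrixP => i j; rewrite !mxE.
Qed.

(** A minor of a diagonal matrix with distinct index sets has a zero row. *)
Lemma wedge_act_diag t v I :
  wedge_act (diag_mx t) v I = (\prod_k t 0 (tnth (val I) k)) * v I.
Proof.
rewrite ffunE (bigD1 I) //= big1 ?addr0 => [|J JI].
  congr (_ * _); transitivity (\det (diag_mx (\row_k t 0 (tnth (val I) k)))).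
    congr (\det _); apply/matrixP => i j.
    by rewrite !mxE (inj_eq (@incr_inj I)).
  by rewrite det_diag; apply: eq_bigr => k _; rewrite mxE.
have [i Ii] : exists i, tnth (val I) i \notin val J.
  apply: contrapT => /forallNP sIJ; case/eqP: JI; apply/esym/incr_sub_eq.
  by move=> _ /tnthP[i ->]; apply: contrapT => /negP /sIJ.
rewrite (expand_det_row _ i) big1 ?mul0r // => j _; rewrite !mxE.
case: eqP => [e|_]; last by rewrite mul0r.
by move: Ii; rewrite e mem_tnth.
Qed.

Lemma wedge_act_diag_pluck t M :
  wedge_act (diag_mx t) (pluck M) = pluck (diag_mx t *m M).
Proof.
apply/ffunP => I; rewrite wedge_act_diag !ffunE mul_diag_mx.
transitivity (\det (diag_mx (\row_k t 0 (tnth (val I) k))) *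
    \det (rowsub (tnth (val I)) M)).
  by rewrite det_diag; congr (_ * _); apply: eq_bigr => k _; rewrite mxE.
rewrite -det_mulmx mul_diag_mx; congr (\det _).
by apply/matrixP => i j; rewrite !mxE.
Qed.

Lemma wedge_act_diagM t (g : 'M[F]_n) w :
  wedge_act (diag_mx t) (wedge_act g (e_ F w)) = wedge_act (diag_mx t *m g) (e_ F w).
Proof.
rewrite !wedge_act_e wedge_act_diag_pluck; congr pluck.
by apply/matrixP => i j; rewrite !mul_diag_mx !mxE.
Qed.

Lemma wedge_act_diag_eq0 t v : (forall i, t 0 i != 0) ->
  (wedge_act (diag_mx t) v == 0) = (v == 0).
Proof.
move=> t0; apply/eqP/eqP => [tv|->].
  apply/ffunP => I; have /eqP := congr1 (fun u : coord_vec F _ => u I) tv.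
  rewrite wedge_act_diag !ffunE mulf_eq0 prodf_seq_eq0 => /orP[/hasP[k _ /=]|/eqP//].
  by rewrite (negPf (t0 _)).
by apply/ffunP => I; rewrite wedge_act_diag !ffunE mulr0.
Qed.

End Pluecker.

Section Cone.
Variables (F : fieldType) (r n : nat).
Implicit Types (X : set (pspace F (incr r n))) (v : coord_vec F (incr r n)).

Lemma torus_diag (t : 'M[F]_n) : torus t ->
  exists d : 'rV_n, [/\ t = diag_mx d, \prod_i d 0 i = 1 & forall i, d 0 i != 0].
Proof.
move=> [dt /diag_mxP[d td]]; exists d; move: dt; rewrite td det_diag => d1.
split=> // i; apply/eqP => di; move/eqP: d1.
by rewrite (bigD1 i) //= di mul0r eq_sym oner_eq0.
Qed.

Lemma heval_diag d (P : {mpoly F[#|incr r n|]}) (t : 'rV_n) : P \is d.-homog ->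
  exists Q : {mpoly F[#|incr r n|]}, Q \is d.-homog /\
    forall v, heval Q v = heval P (wedge_act (diag_mx t) v).
Proof.
move: d P; apply: dhomog_ind => [|d i p [q [hq qE]]|d|d c p p' [q [hq qE]] [q' [hq' qE']]].
- by exists 1; split=> [|v]; rewrite ?dhomog1 // /heval !meval1.
- exists ((\prod_k t 0 (tnth (val (enum_val i)) k)) *: 'X_i * q); split=> [|v].
    by rewrite -[d.+1]/(1 + d)%N dhomogM // dhomogZ // dhomogX /= mdeg1.
  by rewrite !hevalM qE /heval mevalZ !mevalXU wedge_act_diag.
- by exists 0; split=> [|v]; rewrite ?dhomog0 // /heval !meval0.
- exists (c *: q + q'); split=> [|v]; first by rewrite dhomogD ?dhomogZ.
  by rewrite !heval_lin qE qE'.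
Qed.

(** The orbit closures are stable under a diagonal matrix as soon as the group
    is stable under multiplication by it: the matrix pulls a form back to a
    form of the same degree. *)
Lemma closure_orbit_diag (K : set 'M[F]_n) w (t : 'rV_n) (L M : line F (incr r n)) v :
  (forall i, t 0 i != 0) -> (forall g, K g -> K (diag_mx t *m g)) ->
  zariski_closure (orbit_of K w) L -> v \in val L -> v != 0 ->
  wedge_act (diag_mx t) v \in val M -> zariski_closure (orbit_of K w) M.
Proof.
move=> t0 Kt clL vL v0 tvM _ [S Sh ->] [P SP PM]; have [d hP] := Sh _ SP.
have tv0 : wedge_act (diag_mx t) v != 0 by rewrite wedge_act_diag_eq0.
have [Q [hQ QE]] := heval_diag t hP.
have [L' []] : [set L' | exists2 R, [set Q] R & ~ vanishes R L'] `&` orbit_of K w !=set0.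
  apply: clL; first by exists [set Q] => // _ ->; exists d.
  exists Q => //; rewrite (vanishesP hQ vL v0) QE.
  by rewrite -(vanishesP hP tvM tv0).
move=> [_ ->] QL' [g Kg L'E].
have g0 : wedge_act g (e_ F w) != 0.
  by apply/eqP => g0; have := valP L'; rewrite L'E g0 dim_vline eqxx.
have tg0 : wedge_act (diag_mx t) (wedge_act g (e_ F w)) != 0.
  by rewrite wedge_act_diag_eq0.
exists (line_through tg0); split; last first.
  by exists (diag_mx t *m g); [exact: Kt|rewrite -wedge_act_diagM].
exists P => //; rewrite (vanishesP (L := line_through tg0) hP (memv_line _) tg0) -QE.
by rewrite -(vanishesP hQ (L := L')) // L'E memv_line.
Qed.

Lemma torus_richardson (i j : incr r n) (L M : line F (incr r n)) (t : 'M[F]_n) u : torus t ->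
  richardson i j L -> u \in val L -> u != 0 -> wedge_act t u \in val M ->
  richardson i j M.
Proof.
move=> /torus_diag[d [-> d1 d0]] [Lw Lv] uL u0 tuM.
have det1 : \det (diag_mx d) = 1 by rewrite det_diag.
split.
  apply: (closure_orbit_diag d0 _ Lw uL u0 tuM) => g [g1 gt].
  split; first by rewrite det_mulmx det1 g1 mulr1.
  apply/is_trig_mxP => k l kl; rewrite mul_diag_mx !mxE.
  by move/is_trig_mxP: gt => /(_ k l kl); rewrite mxE => ->; rewrite mulr0.
apply: (closure_orbit_diag d0 _ Lv uL u0 tuM) => g [g1 gt].
split; first by rewrite det_mulmx det1 g1 mulr1.
apply/is_trig_mxP => k l kl; rewrite mul_diag_mx !mxE.
by move/is_trig_mxP: gt => /(_ k l kl) ->; rewrite mulr0.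
Qed.

Lemma cone_torus (a b : incr r n) (t : 'M[F]_n) v : torus t ->
  cone (richardson a b) v -> cone (richardson a b) (wedge_act t v).
Proof.
move=> tT [v0 [L XL vL]]; have [d [td _ d0]] := torus_diag tT.
have tv0 : wedge_act t v != 0 by rewrite td wedge_act_diag_eq0.
split=> //; exists (line_through tv0); last exact: memv_line.
exact: (torus_richardson (M := line_through tv0) tT XL vL v0 (memv_line _)).
Qed.

Lemma cone_scale X c v : c != 0 -> cone X (c *: v) <-> cone X v.
Proof.
move=> c0; split=> -[v0 [L XL vL]].
  split; first by apply: contraNneq v0 => ->; rewrite scaler0.
  by exists L => //; move: (memvZ c^-1 vL); rewrite scalerK.
by split; [rewrite scaler_eq0 negb_or c0|exists L; rewrite ?memvZ].
Qed.

Lemma H0_scale X k f c v : H0 X k f -> c != 0 -> f (c *: v) = c ^+ k * f v.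
Proof.
move=> [foff floc] c0; have [cv|ncv] := pselect (cone X v); last first.
  by rewrite !foff ?mulr0 // cone_scale.
have [d [P [Q [hP hQ Qv fE]]]] := floc v cv.
have Qcv : heval Q (c *: v) != 0.
  by rewrite (heval_scale _ _ hQ) mulf_neq0 // expf_neq0.
rewrite !fE //; last exact/cone_scale.
rewrite (heval_scale _ _ hP) (heval_scale _ _ hQ) exprD.
by field; rewrite Qv expf_neq0.
Qed.

Lemma H0M X k l f g : H0 X k f -> H0 X l g -> H0 X (k + l) (fun v => f v * g v).
Proof.
move=> [foff floc] [goff gloc]; split=> [v ncv|v cv]; first by rewrite foff ?mul0r.
have [d [P [Q [hP hQ Qv fE]]]] := floc v cv.
have [e [R [S [hR hS Sv gE]]]] := gloc v cv.
exists (d + e)%N, (P * R), (Q * S); rewrite addnACA !dhomogM // hevalM mulf_neq0 //.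
split=> // u cu; rewrite !hevalM mulf_eq0 negb_or => /andP[Qu Su].
by rewrite fE // gE // mulf_div.
Qed.

Lemma H0_lin X k a f g : H0 X k f -> H0 X k g -> H0 X k (fun v => a * f v + g v).
Proof.
move=> [foff floc] [goff gloc]; split=> [v ncv|v cv].
  by rewrite foff ?goff // mulr0 addr0.
have [d [P [Q [hP hQ Qv fE]]]] := floc v cv.
have [e [R [S [hR hS Sv gE]]]] := gloc v cv.
exists (d + e)%N, (a *: (P * S) + R * Q), (Q * S); split.
- rewrite dhomogD ?dhomogZ //; first by rewrite addnAC dhomogM.
  by rewrite -addnA addnC dhomogM.
- exact: dhomogM.
- by rewrite hevalM mulf_neq0.
- move=> u cu; rewrite heval_lin !hevalM mulf_eq0 negb_or => /andP[Qu Su].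
  by rewrite fE // gE //; field; rewrite Qu Su.
Qed.

Lemma H0T_lin X k a f g : H0T X k f -> H0T X k g -> H0T X k (fun v => a * f v + g v).
Proof.
move=> [Hf Tf] [Hg Tg]; split; first exact: H0_lin.
by move=> t v tT cv; rewrite Tf ?Tg.
Qed.

Lemma H0TM X k l f g : H0T X k f -> H0T X l g -> H0T X (k + l) (fun v => f v * g v).
Proof.
move=> [Hf Tf] [Hg Tg]; split; first exact: H0M.
by move=> t v tT cv; rewrite Tf ?Tg.
Qed.

Lemma H0T_poly (v w : incr r n) k (P : {mpoly F[#|incr r n|]}) : P \is k.-homog ->
  (forall t u, torus t -> cone (richardson v w) u ->
     heval P (wedge_act t u) = heval P u) ->
  H0T (richardson v w) k
    (fun u => if `[< cone (richardson v w) u >] then heval P u else 0).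
Proof.
move=> hP inv; split; [split|].
- by move=> u ncu; case: asboolP.
- move=> u cu; exists 0%N, P, 1; rewrite dhomog1 /heval meval1 oner_eq0.
  by split=> // x cx _; case: asboolP => //; rewrite meval1 divr1.
- move=> t u tT cu; rewrite !asboolT //; last exact: cone_torus.
  exact: inv.
Qed.

End Cone.

Section Rescaling.
Variables (F : closedFieldType) (r n : nat).

(** A diagonal matrix is a scalar e times an element of T, with e^n equal to
    its determinant; scalars act on sections of O(n m) with degree n m. *)
Lemma H0T_diag (i j : incr r n) m f (d : 'rV_n) v : (0 < n)%N ->
  (forall k, d 0 k != 0) -> H0T (richardson (F := F) i j) (n * m) f ->
  cone (richardson i j) v ->
  f (wedge_act (diag_mx d) v) = (\prod_k d 0 k) ^+ (r * m) * f v.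
Proof.
move=> n0 d0 [Hf Tf] cv; set c := \prod_k _.
have c0 : c != 0 by rewrite prodf_seq_neq0; apply/allP => k _; rewrite d0.
have [e eE] : exists e, e ^+ n = c.
  have /closed_rootP[e] : size ('X^n - c%:P) != 1%N by rewrite size_XnsubC // eqSS -lt0n.
  by rewrite rootE !hornerE subr_eq0 => /eqP; exists e.
have e0 : e != 0 by apply: contraNneq c0 => e0; rewrite -eE e0 expr0n gtn_eqF.
have tT : torus (diag_mx (e^-1 *: d)).
  split; last by apply/diag_mxP; exists (e^-1 *: d).
  rewrite det_diag; under eq_bigr do rewrite mxE.
  by rewrite big_split /= prodr_const card_ord exprVn eE mulVf.
have -> : wedge_act (diag_mx d) v = e ^+ r *: wedge_act (diag_mx (e^-1 *: d)) v.
  apply/ffunP => K; rewrite wedge_act_diag ffunE wedge_act_diag /GRing.scale /=.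
  under [in RHS]eq_bigr do rewrite mxE.
  rewrite big_split /= prodr_const card_ord exprVn !mulrA mulfV ?mul1r //.
  by rewrite expf_neq0.
rewrite (H0_scale _ Hf) ?expf_neq0 // Tf // -eE -!exprM; congr (e ^+ _ * _); lia.
Qed.

End Rescaling.

(** * Normal forms for generic points of the Schubert variety *)

(* Ordinals and Pluecker indices count from 0. *)
Local Notation "''r' k" := (@Ordinal 7 k isT) (at level 8, k at level 2, format "''r' k").
Local Notation "''c' k" := (@Ordinal 3 k isT) (at level 8, k at level 2, format "''c' k").
Local Notation "''p' k" := (@Ordinal 5 k isT) (at level 8, k at level 2, format "''p' k").
Local Notation pl i j k :=
  (exist _ [tuple 'r i; 'r j; 'r k] isT : incr 3 7).

Lemma forall_ord3 (P : 'I_3 -> Prop) : P 'c 0 -> P 'c 1 -> P 'c 2 -> forall i, P i.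
Proof.
move=> P0 P1 P2 [[|[|[|//]]] hi].
- by rewrite (_ : Ordinal hi = 'c 0) //; apply: val_inj.
- by rewrite (_ : Ordinal hi = 'c 1) //; apply: val_inj.
- by rewrite (_ : Ordinal hi = 'c 2) //; apply: val_inj.
Qed.

Lemma forall_ord7 (P : 'I_7 -> Prop) :
  P 'r 0 -> P 'r 1 -> P 'r 2 -> P 'r 3 -> P 'r 4 -> P 'r 5 -> P 'r 6 -> forall i, P i.
Proof.
move=> P0 P1 P2 P3 P4 P5 P6 [[|[|[|[|[|[|[|//]]]]]]] hi].
- by rewrite (_ : Ordinal hi = 'r 0) //; apply: val_inj.
- by rewrite (_ : Ordinal hi = 'r 1) //; apply: val_inj.
- by rewrite (_ : Ordinal hi = 'r 2) //; apply: val_inj.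
- by rewrite (_ : Ordinal hi = 'r 3) //; apply: val_inj.
- by rewrite (_ : Ordinal hi = 'r 4) //; apply: val_inj.
- by rewrite (_ : Ordinal hi = 'r 5) //; apply: val_inj.
- by rewrite (_ : Ordinal hi = 'r 6) //; apply: val_inj.
Qed.

Lemma big_ord3 (R : Type) (idx : R) (op : Monoid.law idx) (f : 'I_3 -> R) :
  \big[op/idx]_(i < 3) f i = op (f 'c 0) (op (f 'c 1) (f 'c 2)).
Proof.
rewrite !big_ord_recl big_ord0 Monoid.mulm1.
by do 2?congr (op _ _); congr f; apply: val_inj.
Qed.

Lemma big_ord7 (R : Type) (idx : R) (op : Monoid.law idx) (f : 'I_7 -> R) :
  \big[op/idx]_(i < 7) f i =
  op (f 'r 0) (op (f 'r 1) (op (f 'r 2) (op (f 'r 3) (op (f 'r 4) (op (f 'r 5) (f 'r 6)))))).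
Proof.
rewrite !big_ord_recl big_ord0 Monoid.mulm1.
by do 6?congr (op _ _); congr f; apply: val_inj.
Qed.

Lemma big_ord5 (R : Type) (idx : R) (op : Monoid.law idx) (f : 'I_5 -> R) :
  \big[op/idx]_(i < 5) f i =
  op (f 'p 0) (op (f 'p 1) (op (f 'p 2) (op (f 'p 3) (f 'p 4)))).
Proof.
rewrite !big_ord_recl big_ord0 Monoid.mulm1.
by do 4?congr (op _ _); congr f; apply: val_inj.
Qed.

Lemma det3 (R : comPzRingType) (A : 'M[R]_3) :
  \det A = A 'c 0 'c 0 * (A 'c 1 'c 1 * A 'c 2 'c 2 - A 'c 1 'c 2 * A 'c 2 'c 1)
         - A 'c 0 'c 1 * (A 'c 1 'c 0 * A 'c 2 'c 2 - A 'c 1 'c 2 * A 'c 2 'c 0)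
         + A 'c 0 'c 2 * (A 'c 1 'c 0 * A 'c 2 'c 1 - A 'c 1 'c 1 * A 'c 2 'c 0).
Proof.
pose a (i j : nat) := A (inord i) (inord j).
have aE i j : A i j = a i j by rewrite /a !inord_val.
rewrite (expand_det_row _ 'c 0) big_ord3 /cofactor.
rewrite !(expand_det_row _ ord0) !big_ord_recl !big_ord0 /cofactor !det_mx11 !mxE !aE /=.
rewrite /bump /=; ring.
Qed.

Section Slice.
Variable K : comNzRingType.
Implicit Types M : 'M[K]_(7, 3).

(** The condition satisfied by columns 3, 5 and 7 of an upper triangular
    matrix. *)
Definition staircase M := forall (i : 'I_7) (j : 'I_3), (tnth (val w37) j < i)%N -> M i j = 0.

(** The product of the entries that become 1 in the normal form and of the
    leading principal minors of order 2 and 3.  Together with the entry (0, 0)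
    these minors are what column elimination without exchanges needs. *)
Definition generic_minors M : K :=
  M 'r 0 'c 0 * M 'r 1 'c 0 * M 'r 2 'c 0 * M 'r 3 'c 1 * M 'r 4 'c 1 *
  M 'r 5 'c 2 * M 'r 6 'c 2 * (M 'r 0 'c 0 * M 'r 1 'c 1 - M 'r 0 'c 1 * M 'r 1 'c 0) *
  \det (rowsub (tnth (val id37)) M).

Definition slice (a b p q w : K) : 'M[K]_(7, 3) :=
  \matrix_(i < 7, j < 3) (nth [::] [:: [:: 1; 0; 0]; [:: 1; a; - p]; [:: 1; b; - q];
    [:: 0; 1; 0]; [:: 0; 1; w]; [:: 0; 0; 1]; [:: 0; 0; 1]] i)`_j.

Lemma slice_staircase a b p q w : staircase (slice a b p q w).
Proof. by elim/forall_ord7 => j; elim/forall_ord3: j => //= _; rewrite mxE. Qed.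

Lemma generic_minors_slice : generic_minors (slice 1 0 0 (- 1) 0) = 1.
Proof. by rewrite /generic_minors det3 !mxE /=; ring. Qed.

End Slice.

Lemma map_slice (K K' : comNzRingType) (f : {rmorphism K -> K'}) a b p q w :
  map_mx f (slice a b p q w) = slice (f a) (f b) (f p) (f q) (f w).
Proof.
apply/matrixP => i j; rewrite !mxE.
by elim/forall_ord7: i; elim/forall_ord3: j; rewrite /= ?rmorph0 ?rmorph1 ?rmorphN.
Qed.

Lemma map_generic_minors (K K' : comNzRingType) (f : {rmorphism K -> K'}) M :
  generic_minors (map_mx f M) = f (generic_minors M).
Proof.
by rewrite /generic_minors !rmorphM rmorphB !rmorphM -det_map_mx map_mxsub !mxE.
Qed.

Section Field.
Variable F : fieldType.

Lemma heval_pluck_curve r n (M : 'M[{poly F}]_(n, r)) (P : {mpoly F[#|incr r n|]}) :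
  exists q : {poly F}, forall t, q.[t] = heval P (pluck (map_mx (horner_eval t) M)).
Proof.
exists (mmap polyC (fun k => \det (rowsub (tnth (val (enum_val k))) M)) P) => t.
rewrite horner_mmap; apply: meval_eq => k.
by rewrite ffunE -map_mxsub det_map_mx.
Qed.
End Field.

Section ClosedField.
Variable F : closedFieldType.
Implicit Types (M : 'M[F]_(7, 3)).

(** Join M to a member of the slice at which [generic_minors] does not vanish. *)
Lemma staircase_generic M (P : {mpoly F[#|incr 3 7|]}) :
  staircase M -> heval P (pluck M) != 0 ->
  exists M', [/\ staircase M', generic_minors M' != 0 & heval P (pluck M') != 0].
Proof.
move=> sM PM; pose M1 : 'M[F]_(7, 3) := slice 1 0 0 (- 1) 0.
pose C := map_mx polyC M + 'X *: map_mx polyC (M1 - M).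
have CE t : map_mx (horner_eval t) C = M + t *: (M1 - M).
  by apply/matrixP => i j; rewrite !mxE /horner_eval hornerD hornerM hornerX !hornerC.
have [p pE] := heval_pluck_curve C P.
have [||t [pt gt]] := @nonroot2 _ p (generic_minors C) 0 1.
- by rewrite pE CE scale0r addr0.
- rewrite -/(horner_eval 1 _) -map_generic_minors CE scale1r addrC subrK.
  by rewrite generic_minors_slice oner_eq0.
exists (M + t *: (M1 - M)); split.
- move=> i j ij; have M1ij : M1 i j = 0 by exact: slice_staircase.
  by rewrite mxE sM // add0r mxE mxE M1ij add0r mxE sM // oppr0 mulr0.
- by rewrite -CE map_generic_minors.
- by rewrite -CE -pE.
Qed.

Lemma generic_neq0 M : generic_minors M != 0 ->
  [/\ [/\ M 'r 0 'c 0 != 0, M 'r 1 'c 0 != 0 & M 'r 2 'c 0 != 0],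
      M 'r 3 'c 1 != 0 /\ M 'r 4 'c 1 != 0,
      M 'r 5 'c 2 != 0 /\ M 'r 6 'c 2 != 0,
      M 'r 0 'c 0 * M 'r 1 'c 1 - M 'r 0 'c 1 * M 'r 1 'c 0 != 0
    & \det (rowsub (tnth (val id37)) M) != 0].
Proof.
rewrite /generic_minors !mulf_eq0 !negb_or.
by move=> /andP[/andP[/andP[/andP[/andP[/andP[/andP[/andP[]]]]]]]].
Qed.

Lemma generic_pluck_neq0 M : generic_minors M != 0 -> pluck M != 0.
Proof.
move=> /generic_neq0[_ _ _ _ d0]; apply: contraNneq d0 => M0.
by have := congr1 (fun v : coord_vec F _ => v id37) M0; rewrite !ffunE => ->.
Qed.

Lemma generic_borel M (M0 : pluck M != 0) : staircase M -> generic_minors M != 0 ->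
  orbit_of (@borel F 7) w37 (line_through M0).
Proof.
move=> sM /generic_neq0[[_ _ d0] [_ d1] [_ d2] _ _].
(* The entry at (0, 0) makes the determinant equal to 1. *)
pose g := \matrix_(i < 7, j < 7)
  if j == 'r 2 then M i 'c 0 else if j == 'r 4 then M i 'c 1 else
  if j == 'r 6 then M i 'c 2 else
  if i == j then (if j == 'r 0 then (M 'r 2 'c 0 * M 'r 4 'c 1 * M 'r 6 'c 2)^-1 else 1)
  else 0.
have tg : is_trig_mx g^T.
  apply/is_trig_mxP => j i; rewrite 2!mxE.
  elim/forall_ord7: j => /=; elim/forall_ord7: i => //= _; exact: sM.
exists g; first split=> //.
  rewrite -det_tr (det_trig tg) big_ord7 !mxE /=.
  by field; rewrite d0 d1 d2.
rewrite wedge_act_e; congr <[pluck _]>%VS; apply/matrixP => i j; rewrite !mxE.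
by elim/forall_ord3: j.
Qed.

Lemma det_lower3 (N : 'M[F]_(7, 3)) :
  N 'r 0 'c 1 = 0 -> N 'r 0 'c 2 = 0 -> N 'r 1 'c 2 = 0 ->
  \det (rowsub (tnth (val id37)) N) = N 'r 0 'c 0 * N 'r 1 'c 1 * N 'r 2 'c 2.
Proof. by move=> N01 N02 N12; rewrite det3 !mxE N01 N02 N12; ring. Qed.

(** Gaussian elimination on the columns, without exchanges, makes the three
    columns lower triangular. *)
Lemma generic_opp_borel M (M0 : pluck M != 0) : staircase M -> generic_minors M != 0 ->
  orbit_of (@opp_borel F 7) id37 (line_through M0).
Proof.
move=> sM /generic_neq0[[d0 _ _] _ _ q0 p0].
set q := (X in X != 0) in q0; set p := \det _ in p0.
(* The last column solves the 2 x 2 system, of determinant q, that clears rows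
   0 and 1 of the third column. *)
pose A : 'M[F]_3 := \matrix_(i < 3, j < 3) (nth [::] [::
  [:: 1; - (M 'r 0 'c 1 / M 'r 0 'c 0);
      (M 'r 0 'c 1 * M 'r 1 'c 2 - M 'r 0 'c 2 * M 'r 1 'c 1) / q];
  [:: 0; 1; (M 'r 1 'c 0 * M 'r 0 'c 2 - M 'r 0 'c 0 * M 'r 1 'c 2) / q];
  [:: 0; 0; 1]] i)`_j.
have A1 : \det A = 1 by rewrite det3 !mxE /=; ring.
pose N := M *m A.
pose g := \matrix_(i < 7, j < 7)
  if j == 'r 0 then N i 'c 0 else if j == 'r 1 then N i 'c 1 else
  if j == 'r 2 then N i 'c 2 else
  if i == j then (if j == 'r 3 then p^-1 else 1) else 0.
have N01 : N 'r 0 'c 1 = 0 by rewrite mxE big_ord3 !mxE /=; field.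
have N02 : N 'r 0 'c 2 = 0 by rewrite mxE big_ord3 !mxE /= /q; field.
have N12 : N 'r 1 'c 2 = 0 by rewrite mxE big_ord3 !mxE /= /q; field.
have pE : N 'r 0 'c 0 * N 'r 1 'c 1 * N 'r 2 'c 2 = p.
  by rewrite -(det_lower3 N01 N02 N12) -mul_rowsub_mx det_mulmx A1 mulr1.
have tg : is_trig_mx g.
  apply/is_trig_mxP => i j; rewrite mxE.
  elim/forall_ord7: j => /=; elim/forall_ord7: i => //= _.
exists g; first split=> //.
  rewrite (det_trig tg) big_ord7; do 7 rewrite [g _ _]mxE /=.
  by rewrite !mulr1 !mulrA pE mulfV.
rewrite wedge_act_e; congr <[_]>%VS.
transitivity (pluck N); first by rewrite pluck_mulr A1 scale1r.
congr pluck; apply/matrixP => i j; rewrite [RHS]mxE [RHS]mxE.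
by elim/forall_ord3: j.
Qed.

(** A generic staircase matrix lies in the orbits of both Borel subgroups, and
    every staircase matrix is a limit of generic ones. *)
Lemma cone_pluck M : staircase M -> pluck M != 0 ->
  cone (richardson (F := F) id37 w37) (pluck M).
Proof.
move=> sM M0; split=> //; exists (line_through M0); last exact: memv_line.
split=> _ [S Sh ->] [P SP]; have [d hP] := Sh _ SP;
  rewrite (vanishesP (L := line_through M0) hP (memv_line _) M0) => /eqP PM;
  have [M' [sM' gM' PM']] := staircase_generic sM PM;
  exists (line_through (generic_pluck_neq0 gM')); split.
1,3: exists P => //; have M'0 := generic_pluck_neq0 gM';
     by rewrite (vanishesP (L := line_through _) hP (memv_line _) M'0); apply/eqP.
- exact: generic_borel.
- exact: generic_opp_borel.
Qed.

(** By definition of the closure, a form that does not vanish at a point of X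
    does not vanish somewhere on the Borel orbit, hence neither at some
    generic staircase matrix. *)
Lemma richardson_generic d (P : {mpoly F[#|incr 3 7|]}) v : P \is d.-homog ->
  cone (richardson (F := F) id37 w37) v -> heval P v != 0 ->
  exists M, [/\ staircase M, generic_minors M != 0 & heval P (pluck M) != 0].
Proof.
move=> hP [v0 [L [Lw _] vL]] Pv.
have [||L' [[_ -> PL'] [g [_ gt] L'E]]] := Lw [set L | exists2 Q, [set P] Q & ~ vanishes Q L].
- by exists [set P] => // _ ->; exists d.
- by exists P => //; rewrite (vanishesP hP vL v0); apply/eqP.
rewrite wedge_act_e in L'E.
apply: (@staircase_generic (colsub (tnth (val w37)) g)) => [i j ij|].
  rewrite mxE; move/is_trig_mxP: gt => /(_ _ _ ij).
  by rewrite mxE.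
apply/eqP => Pg; apply: PL' => u; rewrite L'E => /vlineP[k ->].
by rewrite (heval_scale _ _ hP) Pg mulr0.
Qed.

(** The diagonal factor makes the nonzero entries of the first column and the
    last two nonzero entries of the other columns equal to 1; the unitriangular
    factor clears row 0 of the second and third column and row 3 of the third. *)
Lemma generic_slice M : staircase M -> generic_minors M != 0 ->
  exists (t : 'rV_7) (a b p q w : F) (A : 'M_3),
    [/\ forall i, t 0 i != 0, \det A = 1 & M = diag_mx t *m slice a b p q w *m A].
Proof.
move=> sM /generic_neq0[[x0 x1 x2] [y3 y4] [z5 z6] _ _].
pose t : 'rV[F]_7 := \row_i (nth 0 [:: M 'r 0 'c 0; M 'r 1 'c 0; M 'r 2 'c 0;
  M 'r 3 'c 1; M 'r 4 'c 1; M 'r 5 'c 2; M 'r 6 'c 2] i).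
pose N i j := M i j / t 0 i.
pose A : 'M[F]_3 := \matrix_(i < 3, j < 3) (nth [::] [::
  [:: 1; N 'r 0 'c 1; N 'r 0 'c 2]; [:: 0; 1; N 'r 3 'c 2]; [:: 0; 0; 1]] i)`_j.
pose S i := N i 'c 2 - N 'r 3 'c 2 * (N i 'c 1 - N 'r 0 'c 1) - N 'r 0 'c 2.
exists t, (N 'r 1 'c 1 - N 'r 0 'c 1), (N 'r 2 'c 1 - N 'r 0 'c 1),
  (- S 'r 1), (- S 'r 2), (N 'r 4 'c 2 - N 'r 3 'c 2), A; split.
- by elim/forall_ord7; rewrite mxE.
- by rewrite det3 !mxE /=; ring.
apply/matrixP => i j; rewrite mul_diag_mx [RHS]mxE big_ord3 !mxE.
elim/forall_ord7: i; elim/forall_ord3: j; rewrite /= ?mxE /S /N ?mxE /=;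
  rewrite ?(sM 'r 3 'c 0) ?(sM 'r 4 'c 0) ?(sM 'r 5 'c 0) ?(sM 'r 5 'c 1)
    ?(sM 'r 6 'c 0) ?(sM 'r 6 'c 1) //;
  by field; rewrite ?x0 ?x1 ?x2 ?y3 ?y4.
Qed.
End ClosedField.

(** * The seven invariant sections of lowest degree *)

Definition scroll_degrees (i : 'I_3) : nat := nth 0%N [:: 1; 1; 2]%N i.
Local Notation J := (scroll_index scroll_degrees).

Definition triple (F : fieldType) (p q w : F) (i : 'I_3) : F := [:: p; q; w]`_i.

(** The T-invariant monomials in the Pluecker coordinates whose restrictions to
    the slice are a p, b p; a q, b q; a^2 w, a b w, b^2 w. *)
Definition columns (u : J) : seq (incr 3 7) :=
  nth [::] (nth [::] [::
    [:: [:: pl 0 1 3; pl 0 1 5; pl 0 3 5; pl 1 3 5; pl 2 4 6; pl 2 4 6; pl 2 4 6];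
        [:: pl 0 1 3; pl 0 2 5; pl 0 3 5; pl 1 3 5; pl 1 4 6; pl 2 4 6; pl 2 4 6]];
    [:: [:: pl 0 2 3; pl 0 1 5; pl 0 3 5; pl 1 3 5; pl 1 4 6; pl 2 4 6; pl 2 4 6];
        [:: pl 0 2 3; pl 0 2 5; pl 0 3 5; pl 1 3 5; pl 1 4 6; pl 1 4 6; pl 2 4 6]];
    [:: [:: pl 0 3 4; pl 0 1 5; pl 0 1 5; pl 1 3 5; pl 2 3 6; pl 2 4 6; pl 2 4 6];
        [:: pl 0 3 4; pl 0 1 5; pl 0 2 5; pl 1 3 5; pl 1 3 6; pl 2 4 6; pl 2 4 6];
        [:: pl 0 3 4; pl 0 2 5; pl 0 2 5; pl 1 3 5; pl 1 3 6; pl 1 4 6; pl 2 4 6]]]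
   (tag u)) (tagged u).

Local Notation si i k := (@Tagged _ 'c i (fun t => 'I_(scroll_degrees t).+1)
  (@Ordinal (scroll_degrees 'c i).+1 k isT) : J).

Lemma forall_scroll_index (P : J -> Prop) :
  P (si 0 0) -> P (si 0 1) -> P (si 1 0) -> P (si 1 1) ->
  P (si 2 0) -> P (si 2 1) -> P (si 2 2) -> forall u, P u.
Proof.
move=> P00 P01 P10 P11 P20 P21 P22 [t]; elim/forall_ord3: t => -[k hk];
  case: k hk => [|[|[|k]]] hk; by [move: (hk)|rewrite (bool_irrelevance hk isT)].
Qed.

Lemma columns_size (u : J) : size (columns u) = 7%N.
Proof. by elim/forall_scroll_index: u. Qed.

(** Each of the seven indices occurs three times. *)
Lemma columns_weight (u : J) :
  perm_eq (flatten [seq tval (val w) | w : incr 3 7 <- columns u])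
    (flatten (nseq 3 [:: 'r 0; 'r 1; 'r 2; 'r 3; 'r 4; 'r 5; 'r 6])).
Proof. by elim/forall_scroll_index: u; vm_compute. Qed.

Section Sections.
Variable F : closedFieldType.
Local Notation X := (richardson (F := F) id37 w37).

Definition section_mpoly (u : J) : {mpoly F[#|incr 3 7|]} :=
  \prod_(w <- columns u) 'X_(enum_rank w).

Definition scroll_section (u : J) (v : coord_vec F (incr 3 7)) : F :=
  if `[< cone X v >] then heval (section_mpoly u) v else 0.

Lemma heval_section u v : heval (section_mpoly u) v = \prod_(w <- columns u) v w.
Proof.
by rewrite /section_mpoly /heval rmorph_prod; apply: eq_bigr => w _ /=; rewrite mevalXU enum_rankK.
Qed.

Lemma section_homog u : section_mpoly u \is 7.-homog.
Proof.
have h (l : seq (incr 3 7)) :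
    \prod_(w <- l) ('X_(enum_rank w) : {mpoly F[#|incr 3 7|]}) \is (size l).-homog.
  elim: l => [|w l IH]; first by rewrite big_nil dhomog1.
  by rewrite big_cons -[size _]/(1 + size l)%N dhomogM // dhomogX /= mdeg1.
by have := h (columns u); rewrite columns_size.
Qed.

(** The character by which a diagonal matrix acts on the monomial is the cube
    of its determinant. *)
Lemma scroll_section_H0T u : H0T X 7 (scroll_section u).
Proof.
apply: H0T_poly; first exact: section_homog.
move=> t v /torus_diag[d [-> d1 _]] _; rewrite !heval_section.
under eq_bigr do rewrite wedge_act_diag.
rewrite big_split -[RHS]mul1r; congr (_ * _).
transitivity (\prod_(i <- flatten [seq tval (val w) | w : incr 3 7 <- columns u]) d 0 i).
  rewrite big_flatten big_map; apply: eq_bigr => I _.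
  by rewrite big_tuple.
rewrite (perm_big _ (columns_weight u)) big_flatten /= !big_cons !big_nil /=.
rewrite big_ord7 in d1; move: d1 => /= d1.
by rewrite !mulr1 !d1 !mulr1.
Qed.

Definition slice_point (v : 'I_5 -> F) : coord_vec F (incr 3 7) :=
  pluck (slice (v (@Ordinal 5 0 isT)) (v (@Ordinal 5 1 isT)) (v (@Ordinal 5 2 isT))
    (v (@Ordinal 5 3 isT)) (v (@Ordinal 5 4 isT))).

Lemma slice_pluck_neq0 (a b p q w : F) : pluck (slice a b p q w) != 0.
Proof.
apply/eqP => e0; have := congr1 (fun v : coord_vec F _ => v (pl 0 3 5)) e0.
rewrite /= !ffunE det3 !mxE /= => /eqP; rewrite (_ : _ - _ + _ = 1) ?oner_eq0 //.
ring.
Qed.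

Lemma cone_slice (a b p q w : F) : cone X (pluck (slice a b p q w)).
Proof. exact: cone_pluck (slice_staircase _ _ _ _ _) (slice_pluck_neq0 _ _ _ _ _). Qed.

Lemma pluck_pl r0 r1 r2 (h : sorted ltn (map val (val [tuple r0; r1; r2])))
    (M : 'M[F]_(7, 3)) :
  pluck M (exist _ [tuple r0; r1; r2] h : incr 3 7) =
    M r0 'c 0 * (M r1 'c 1 * M r2 'c 2 - M r1 'c 2 * M r2 'c 1)
  - M r0 'c 1 * (M r1 'c 0 * M r2 'c 2 - M r1 'c 2 * M r2 'c 0)
  + M r0 'c 2 * (M r1 'c 0 * M r2 'c 1 - M r1 'c 1 * M r2 'c 0).
Proof. by rewrite ffunE det3 !mxE. Qed.

Lemma minors_slice (a b p q w : F) (v := pluck (slice a b p q w)) :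
  (v (pl 0 1 3) = p) * (v (pl 0 2 3) = q) * (v (pl 0 1 5) = a) * (v (pl 0 2 5) = b) *
  (v (pl 0 3 4) = w) * (v (pl 0 3 5) = 1) * (v (pl 1 3 5) = 1) * (v (pl 1 3 6) = 1) *
  (v (pl 1 4 6) = 1) * (v (pl 2 3 6) = 1) * (v (pl 2 4 6) = 1).
Proof. by rewrite /v !pluck_pl !mxE /=; do 10?[split; last by ring]; ring. Qed.

Lemma scroll_section_slice (u : J) (a b p q w : F) :
  scroll_section u (pluck (slice a b p q w)) = scroll_vec scroll_degrees a b (triple p q w) u.
Proof.
rewrite /scroll_section asboolT; last exact: cone_slice.
rewrite heval_section ffunE.
elim/forall_scroll_index: u; rewrite /columns [tag _]/= [tagged _]/= [nth _ _ _]/=;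
  rewrite !big_cons big_nil !minors_slice /triple /scroll_degrees /=; ring.
Qed.
End Sections.

(** * Restriction of invariant sections to the slice *)

Section Pullback.
Variable F : closedFieldType.
Local Notation X := (richardson (F := F) id37 w37).

Lemma cone_slice_point v : cone X (slice_point v).
Proof. exact: cone_slice. Qed.

(** The action on the slice parameters (a, b, p, q, w) of the subtorus that
    preserves the slice up to column scalings; the exponents are the two
    weights. *)
Definition rescale (al be : F) (v : 'I_5 -> F) : 'I_5 -> F := fun k =>
  al ^+ nth 0%N [:: 1; 1; 1; 1; 0]%N k * be ^+ nth 0%N [:: 0; 0; 1; 1; 1]%N k * v k.

Lemma diag_slice (al be : F) (v : 'I_5 -> F) : al != 0 -> be != 0 ->
  wedge_act (diag_mx (\row_i [:: al * be; al * be; al * be; be; be; 1; 1]`_i)) (slice_point v) =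
  (al * be * be) *: slice_point (rescale al be v).
Proof.
move=> al0 be0; rewrite /slice_point wedge_act_diag_pluck.
set S := slice _ _ _ _ _; set S' := slice _ _ _ _ _.
have -> : (al * be * be) = \det (diag_mx (\row_(i < 3) [:: al * be; be; 1]`_i)).
  by rewrite det_diag big_ord3 !mxE /= mulr1.
rewrite -pluck_mulr; congr pluck; apply/matrixP => i j.
rewrite mul_diag_mx mul_mx_diag !mxE /rescale.
by elim/forall_ord7: i; elim/forall_ord3: j => /=; ring.
Qed.

Lemma slice_point_bihomog m f (al be : F) v : H0T X (7 * m) f -> al != 0 -> be != 0 ->
  f (slice_point (rescale al be v)) = al ^+ (2 * m) * be ^+ m * f (slice_point v).
Proof.
move=> Tf al0 be0.
pose d : 'rV[F]_7 := \row_i [:: al * be; al * be; al * be; be; be; 1; 1]`_i.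
have d0 i : d 0 i != 0.
  by rewrite mxE; elim/forall_ord7: i => /=; rewrite ?oner_eq0 ?mulf_neq0.
have := H0T_diag (isT : 0 < 7)%N d0 Tf (cone_slice_point v).
rewrite /d diag_slice // (H0_scale _ Tf.1) ?mulf_neq0 //.
rewrite big_ord7 !mxE /= => e.
have c0 : (al * be * be) ^+ (7 * m) != 0 by rewrite expf_neq0 // !mulf_neq0.
apply: (mulfI c0); rewrite e [RHS]mulrA; congr (_ * _).
rewrite !mulr1 !exprMn.
have -> : (3 * m = m + m + m)%N by lia.
have -> : (7 * m = m + m + m + m + m + m + m)%N by lia.
have -> : (2 * m = m + m)%N by lia.
rewrite !exprD; ring.
Qed.

(** The slice never leaves the punctured cone, so the local fractions of f pull
    back to local fractions at every point of affine 5-space. *)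
Lemma slice_point_polyfun k f : H0 X k f -> polyfun (fun v => f (slice_point v)).
Proof.
move=> [_ floc]; apply: locally_fraction_polyfun => v.
have [d [P [Q [_ _ Qv fE]]]] := floc _ (cone_slice (v 'p 0) (v 'p 1) (v 'p 2) (v 'p 3) (v 'p 4)).
(* The Pluecker coordinates of the slice are themselves polynomials in the
   parameters. *)
pose s := [tuple \det (rowsub (tnth (val (enum_val k)))
  (slice 'X_('p 0) 'X_('p 1) 'X_('p 2) 'X_('p 3) 'X_('p 4))) | k < #|incr 3 7|]
  : #|incr 3 7|.-tuple {mpoly F[5]}.
have sE R u : (R \mPo s).@[u] = heval R (slice_point u).
  rewrite comp_mpoly_meval; apply: meval_eq => l; rewrite tnth_mktuple ffunE.
  by rewrite -det_map_mx map_mxsub map_slice /= !mevalXU.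
exists (P \mPo s), (Q \mPo s); rewrite sE; split=> // u; rewrite !sE => Qu.
by apply: fE => //; exact: cone_slice.
Qed.

(** A section that vanishes on the slice vanishes at all generic staircase
    matrices.  If it were nonzero at a point of X, where it is a fraction
    P / Q, then P Q would be a form that is nonzero at some generic staircase
    matrix. *)
Lemma H0T_eq_slice m f g : H0T X (7 * m) f -> H0T X (7 * m) g ->
  (forall v, f (slice_point v) = g (slice_point v)) -> f = g.
Proof.
move=> Tf Tg fg.
have := H0T_lin (-1) Tf Tg; set h := (fun v => _) => Th.
suff h0 v : h v = 0.
  by apply: funext => v; move: (h0 v); rewrite /h mulN1r addrC => /eqP; rewrite subr_eq0 => /eqP.
have hp u : h (slice_point u) = 0 by rewrite /h fg mulN1r addNr.
have [cv|ncv] := pselect (cone X v); last exact: Th.1.1.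
have [d [P [Q [hP hQ Qv hE]]]] := Th.1.2 v cv.
rewrite (hE _ cv Qv); apply/eqP; rewrite mulf_eq0 invr_eq0 (negPf Qv) orbF.
apply/negPn/negP => Pv.
have [|M [sM gM]] := richardson_generic (P := P * Q) (dhomogM hP hQ) cv.
  by rewrite hevalM mulf_neq0.
rewrite hevalM mulf_eq0 negb_or => /andP[PM QM].
have cM := cone_pluck sM (generic_pluck_neq0 gM).
have := hE _ cM QM => /eqP; rewrite eq_sym (_ : h (pluck M) = 0); last first.
  have [t [a [b [p [q [w [A [t0 A1 ->]]]]]]]] := generic_slice sM gM.
  rewrite pluck_mulr A1 scale1r -wedge_act_diag_pluck.
  rewrite (H0T_diag (isT : 0 < 7)%N t0 Th (cone_slice _ _ _ _ _)).
  by move: (hp (fun k : 'I_5 => [:: a; b; p; q; w]`_k)) => ->; rewrite mulr0.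
by rewrite mulf_eq0 invr_eq0 (negPf QM) (negPf PM).
Qed.

(** Peel off one scroll coordinate at a time: one containing p or q if such a
    factor is left, and otherwise w times two factors among a and b, which the
    degree conditions provide. *)
Lemma scroll_monomial m i j k l n : (i + j + k + l = 2 * m)%N -> (k + l + n = m)%N ->
  exists2 G : {mpoly F[#|J|]}, G \is m.-homog & forall x y p q w,
    heval G (scroll_vec scroll_degrees x y (triple p q w)) =
    x ^+ i * y ^+ j * p ^+ k * q ^+ l * w ^+ n.
Proof.
elim: m i j k l n => [|m IH] i j k l n e1 e2.
  have [-> -> -> -> ->] : [/\ i = 0, j = 0, k = 0, l = 0 & n = 0]%N by split; lia.
  by exists 1; [exact: dhomog1|move=> *; rewrite /heval meval1; ring].
have step u i' j' k' l' n' : (i' + j' + k' + l' = 2 * m)%N -> (k' + l' + n' = m)%N ->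
    (forall x y p q w : F, scroll_vec scroll_degrees x y (triple p q w) u *
       (x ^+ i' * y ^+ j' * p ^+ k' * q ^+ l' * w ^+ n') =
       x ^+ i * y ^+ j * p ^+ k * q ^+ l * w ^+ n) ->
    exists2 G : {mpoly F[#|J|]}, G \is m.+1.-homog & forall x y p q w,
      heval G (scroll_vec scroll_degrees x y (triple p q w)) =
      x ^+ i * y ^+ j * p ^+ k * q ^+ l * w ^+ n.
  move=> e1' e2' e; have [G hG GE] := IH _ _ _ _ _ e1' e2'.
  exists ('X_(enum_rank u) * G); first by rewrite -[m.+1]/(1 + m)%N dhomogM // dhomogXi.
  by move=> *; rewrite hevalM hevalX GE e.
have [k0|k0] := posnP k; last first.
  have [i0|i0] := posnP i.
    apply: (step (si 0 1) i j.-1 k.-1 l n); try lia.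
    by move=> *; rewrite ffunE /triple /= -(prednK k0) -[j in RHS](@prednK j);
      [rewrite !exprS; ring|lia].
  apply: (step (si 0 0) i.-1 j k.-1 l n); try lia.
  by move=> *; rewrite ffunE /triple /= -(prednK k0) -(prednK i0) !exprS; ring.
have [l0|l0] := posnP l; last first.
  have [i0|i0] := posnP i.
    apply: (step (si 1 1) i j.-1 k l.-1 n); try lia.
    by move=> *; rewrite ffunE /triple /= -(prednK l0) -[j in RHS](@prednK j);
      [rewrite !exprS; ring|lia].
  apply: (step (si 1 0) i.-1 j k l.-1 n); try lia.
  by move=> *; rewrite ffunE /triple /= -(prednK l0) -(prednK i0) !exprS; ring.
have n0 : (0 < n)%N by lia.
case: i e1 step => [|[|i]] e1 step.
- apply: (step (si 2 2) 0%N j.-2 k l n.-1); try lia.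
  have -> : j = j.-2.+2 by lia.
  by move=> *; rewrite ffunE /triple /= -(prednK n0) !exprS; ring.
- apply: (step (si 2 1) 0%N j.-1 k l n.-1); try lia.
  have -> : j = j.-1.+1 by lia.
  by move=> *; rewrite ffunE /triple /= -(prednK n0) !exprS; ring.
- apply: (step (si 2 0) i j k l n.-1); try lia.
  by move=> *; rewrite ffunE /triple /= -(prednK n0) !exprS; ring.
Qed.

End Pullback.

(** * The ring of invariants and its projective spectrum *)

Section GitRing.
Variable F : closedFieldType.
Local Notation X := (richardson (F := F) id37 w37).
Local Notation s := (@scroll_section F).
Local Notation ev := (section_eval s (cone X)).

Lemma scroll_section_off j x : ~ cone X x -> s j x = 0.
Proof. by move=> ncx; rewrite /scroll_section asboolF. Qed.

Lemma section_eval_slice G (a b p q w : F) :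
  ev G (pluck (slice a b p q w)) = heval G (scroll_vec scroll_degrees a b (triple p q w)).
Proof.
rewrite /section_eval asboolT; last exact: cone_slice.
by congr heval; apply/ffunP => u; rewrite ffunE scroll_section_slice.
Qed.

Lemma section_eval_H0T m G : G \is m.-homog -> H0T X (7 * m) (ev G).
Proof.
move: m G; apply: dhomog_ind => [|d i p IH|d|d c p q IHp IHq].
- rewrite muln0; have := @H0T_poly F 3 7 id37 w37 0%N 1 (dhomog1 _ _).
  have -> : ev 1 = (fun u => if `[< cone X u >] then heval 1 u else 0).
    by apply: funext => u; rewrite /section_eval /heval !meval1.
  by apply=> *; rewrite /heval !meval1.
- rewrite -(enum_valK i) section_evalM section_evalX; last exact: scroll_section_off.
  by rewrite mulnS; apply: H0TM => //; exact: scroll_section_H0T.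
- rewrite section_eval0; split; last by [].
  split=> // v cv; exists 0%N, 0, 1; rewrite dhomog0 dhomog1 /heval meval1 oner_eq0.
  by split=> // u _ _; rewrite meval0 mul0r.
- by rewrite section_eval_lin; exact: H0T_lin.
Qed.

(** Of the polynomial that represents f on the slice only the monomials of the
    right bidegree survive, and these are forms in the scroll coordinates. *)
Lemma slice_point_homog m f : H0T X (7 * m) f ->
  exists2 G : {mpoly F[#|J|]}, G \is m.-homog & forall v, f (slice_point v) =
    heval G (scroll_vec scroll_degrees (v 'p 0) (v 'p 1) (triple (v 'p 2) (v 'p 3) (v 'p 4))).
Proof.
move=> Tf; have [p pE] := slice_point_polyfun Tf.1.
have pE1 v : f (slice_point v) = \sum_(k <- msupp p | xpredT k) p@_k * \prod_i v i ^+ k i.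
  by rewrite pE mevalE.
have h1 al v : al != 0 ->
    f (slice_point (fun i => al ^+ nth 0%N [:: 1; 1; 1; 1; 0]%N i * v i)) =
    al ^+ (2 * m) * f (slice_point v).
  move=> al0; have := slice_point_bihomog v Tf al0 (oner_neq0 F).
  rewrite expr1n mulr1 => <-; congr (f (slice_point _)); apply: funext => i.
  by rewrite /rescale expr1n mulr1.
have pE2 := weight_filter pE1 h1.
have h2 be v : be != 0 ->
    f (slice_point (fun i => be ^+ nth 0%N [:: 0; 0; 1; 1; 1]%N i * v i)) =
    be ^+ m * f (slice_point v).
  move=> be0; have := slice_point_bihomog v Tf (oner_neq0 F) be0.
  rewrite expr1n mul1r => <-; congr (f (slice_point _)); apply: funext => i.
  by rewrite /rescale expr1n mul1r.
pose P (k : 'X_{1..5}) := true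
  && ((\sum_(i < 5) nth 0 [:: 1; 1; 1; 1; 0] i * k i)%N == (2 * m)%N)
  && ((\sum_(i < 5) nth 0 [:: 0; 0; 1; 1; 1] i * k i)%N == m).
have pE3 v : f (slice_point v) = \sum_(k <- msupp p | P k) p@_k * \prod_i v i ^+ k i.
  exact: (weight_filter pE2 h2).
have /choice[g gP] k : exists G : {mpoly F[#|J|]}, P k -> G \is m.-homog /\
    forall v : 'I_5 -> F, heval G (scroll_vec scroll_degrees (v 'p 0) (v 'p 1)
      (triple (v 'p 2) (v 'p 3) (v 'p 4))) = \prod_i v i ^+ k i.
  have [|_] := boolP (P k); last by exists 0.
  rewrite /P /= !big_ord5 /= => /andP[/eqP e1 /eqP e2].
  have [||G hG GE] := @scroll_monomial F m (k 'p 0) (k 'p 1) (k 'p 2) (k 'p 3) (k 'p 4).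
  - by move: e1; rewrite !mul1n mul0n addn0 !addnA.
  - by move: e2; rewrite !mul1n !mul0n !add0n !addnA.
  by exists G => _; split=> // v; rewrite GE big_ord5 /= !mulrA.
exists (\sum_(k <- msupp p | P k) p@_k *: g k) => [|v].
  by apply: rpred_sum => k /gP[hg _]; exact: dhomogZ.
rewrite pE3 /heval raddf_sum; apply: eq_bigr => k /gP[_ gE] /=.
by rewrite mevalZ -gE.
Qed.

Lemma git_ring_generated m f :
  git_ring X 7 m f <-> exists2 G, G \is m.-homog & f = ev G.
Proof.
split=> [Tf|[G hG ->]]; last exact: section_eval_H0T.
have [G hG GE] := slice_point_homog Tf; exists G => //.
by apply: (H0T_eq_slice Tf (section_eval_H0T hG)) => v; rewrite GE section_eval_slice.
Qed.

Lemma section_eval_eq0 m G : G \is m.-homog ->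
  (forall x y lam, heval G (scroll_vec scroll_degrees x y lam) = 0) -> ev G = fun=> 0.
Proof.
move=> hG G0; rewrite -(section_eval0 s (cone X)).
apply: (H0T_eq_slice (section_eval_H0T hG) (section_eval_H0T (dhomog0 _ _ _))) => v.
by rewrite !section_eval_slice G0 /heval meval0.
Qed.

Lemma triple_eta (lam : 'I_3 -> F) : triple (lam (@Ordinal 3 0 isT)) (lam (@Ordinal 3 1 isT))
  (lam (@Ordinal 3 2 isT)) = lam.
Proof. by apply: funext; elim/forall_ord3. Qed.

(** The restrictions of the generators to the slice parametrize the cone over
    the scroll, and restriction is injective.  So the relations among the
    generators are exactly the forms that vanish on the scroll, and the 2 x 2
    minors that cut out the scroll are among them. *)
Lemma kernel_locus_scroll :
  kernel_locus s (cone X) = scroll (F := F) (a := scroll_degrees).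
Proof.
apply/seteqP; split=> [L LZ|L [x [y [lam LE]]] m G hG G0 v].
  have [z zL z0] := line_neq0 L.
  apply: (scroll_of_minors zL z0) => i j k l.
  set A := Tagged _ _; set B := Tagged _ _; set C := Tagged _ _; set D := Tagged _ _.
  pose G : {mpoly F[#|J|]} := - 1 *: ('X_(enum_rank C) * 'X_(enum_rank D)) +
    'X_(enum_rank A) * 'X_(enum_rank B).
  have GE u : heval G u = u A * u B - u C * u D.
    by rewrite heval_lin !hevalM !hevalX mulN1r addrC.
  have hG : G \is 2.-homog.
    by rewrite dhomogD ?dhomogZ // -[2%N]/(1 + 1)%N dhomogM // dhomogXi.
  have := LZ 2%N G hG; rewrite (section_eval_eq0 hG) => [/(_ erefl z zL)|x y lam].
    by rewrite GE => /eqP; rewrite subr_eq0 => /eqP.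
  rewrite GE !ffunE /= /bump /= !add1n -(subnSK (ltn_ord k)) -(subnSK (ltn_ord l)) !exprS.
  by ring.
rewrite LE => /vlineP[c ->]; rewrite (heval_scale _ _ hG).
move: (congr1 (fun f => f (pluck (slice x y (lam (@Ordinal 3 0 isT))
  (lam (@Ordinal 3 1 isT)) (lam (@Ordinal 3 2 isT))))) G0).
by rewrite section_eval_slice triple_eta => ->; rewrite mulr0.
Qed.

Lemma scroll_section_basis : is_basis (git_ring X 7 1%N) s.
Proof.
split=> [j|f /git_ring_generated[G hG fE]].
  exact: scroll_section_H0T.
have [c cE] : exists c : {ffun J -> F}, f = (fun v => \sum_j c j * s j v).
  have [c GE] := homog1_linear hG; exists c; rewrite fE; apply: funext => v.
  rewrite /section_eval; have [cv|ncv] := asboolP.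
    by rewrite GE; apply: eq_bigr => j _; rewrite ffunE.
  by rewrite big1 // => j _; rewrite scroll_section_off // mulr0.
exists c; split=> // c' c'E; apply/ffunP => j; apply/eqP; rewrite -subr_eq0; apply/eqP.
apply: (scroll_vec_free (c := fun j => c j - c' j)) => x y lam.
have := congr1 (fun f => f (pluck (slice x y (lam (@Ordinal 3 0 isT))
  (lam (@Ordinal 3 1 isT)) (lam (@Ordinal 3 2 isT))))) (etrans (esym cE) c'E).
move=> /= /eqP; rewrite -subr_eq0 -sumrB => /eqP e; rewrite -[RHS]e.
apply: eq_bigr => u _; rewrite scroll_section_slice triple_eta; ring.
Qed.

Theorem git_scroll : is_rational_normal_scroll (git_ring X 7).
Proof.
have [h [hs he]] := proj_embedding scroll_section_off git_ring_generated.
exists 3%N, scroll_degrees, s, h; split=> //.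
- by split=> //; elim/forall_ord3.
- exact: scroll_section_basis.
- by rewrite -kernel_locus_scroll.
Qed.
End GitRing.

Theorem theorem5p14 (R : realType) :
  is_rational_normal_scroll
    (git_ring (richardson (F := (complex R : fieldType)) id37 w37) 7).
Proof. exact: (@git_scroll (complex R : closedFieldType)). Qed.
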